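(* Let $a > -1$, let $(\mathcal{T}_n)_{n=1}^\infty$ be the ensemble of linear preferential attachment trees with parameter $a$, and set $\gamma_a := a + 2$. Fix any $k \ge 1$. Write $\lambda_{n,1} \ge \lambda_{n,2} \ge \cdots \ge \lambda_{n,k}$ for the $k$ largest eigenvalues of the adjacency matrix of $\mathcal{T}_n$ and $\Delta_{n,1} \ge \Delta_{n,2} \ge \cdots \ge \Delta_{n,k}$ for the $k$ largest out-degrees of $\mathcal{T}_n$. There exist random variables $X_1 \ge X_2 \ge \cdots \ge X_k > 0$ such that \[ \left(\frac{\Delta_{n,1}}{n^{1/\gamma_a}}, \frac{\Delta_{n,2}}{n^{1/\gamma_a}}, \ldots, \frac{\Delta_{n,k}}{n^{1/\gamma_a}}\right) \] converges in distribution to $(X_1, X_2, \ldots, X_k)$ as $n \to \infty$. Hence, \[ \left(\frac{\lambda_{n,1}}{n^{1/2\gamma_a}}, \frac{\lambda_{n,2}}{n^{1/2\gamma_a}}, \ldots, \frac{\lambda_{n,k}}{n^{1/2\gamma_a}}\right) \] converges in distribution to $(\sqrt{X_1}, \sqrt{X_2}, \ldots, \sqrt{X_k})$ as $n \to \infty$. (Here $n^{1/2\gamma_a} = n^{1/(2\gamma_a)}$.)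
   Context: Linear preferential attachment tree with parameter $a > -1$: start with a single vertex (the root, labeled $1$) at time $1$. Suppose the tree $\mathcal{T}_n$ on vertices $[n] = \{1, \ldots, n\}$ has been constructed. Think of edges as directed away from the root and let $D(v,n)$ be the out-degree (number of children) of vertex $v \in [n]$ in $\mathcal{T}_n$. The tree $\mathcal{T}_{n+1}$ is obtained by adding an edge between the new vertex $n+1$ and a vertex $v \in [n]$ chosen (given the past) with probability proportional to $D(v,n) + 1 + a$; the new vertex is a child of $v$. *)

(* Defs.v *)
Set Warnings "-notation-overridden,-notation-incompatible-prefix".
From HB Require Import structures.
From mathcomp Require Import all_boot all_order all_algebra.
From mathcomp Require Import all_classical all_reals all_analysis.
From mathcomp Require Import polyrcf.

Set Implicit Arguments.
Unset Strict Implicit.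
Unset Printing Implicit Defensive.

Import Order.TTheory GRing.Theory Num.Theory.
Import numFieldNormedType.Exports.

Local Open Scope classical_set_scope.
Local Open Scope ring_scope.

(* The vertex labelled m + 1 in the usual numbering is encoded by m, so the    *)
(* vertex set of the n-th tree is 'I_n and the root is 0. A growing sequence of *)
(* rooted trees is encoded by p : nat -> nat, where p m is the parent of the    *)
(* vertex m > 0 (p 0 is ignored); the n-th tree depends only on p 1, ..,        *)
(* p n.-1.                                                                      *)
Definition tree_edge (p : nat -> nat) (n : nat) : rel 'I_n :=
  [rel u v : 'I_n | (0 < v)%N && (p v == u :> nat)].

Definition outdeg (p : nat -> nat) (n : nat) (v : 'I_n) : nat :=
  #|[pred w : 'I_n | tree_edge p v w]|.

Definition adjmx (R : realType) (p : nat -> nat) (n : nat) : 'M[R]_n :=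
  \matrix_(u < n, v < n) (tree_edge p u v || tree_edge p v u)%:R.

(* The real eigenvalues, repeated according to their multiplicity as roots of   *)
(* the characteristic polynomial, in nonincreasing order.                       *)
Definition eigenvalues (R : realType) (n : nat) (A : 'M[R]_n) : seq R :=
  sort >=%R
    (flatten [seq nseq (mup x (char_poly A)) x | x <- rootsR (char_poly A)]).

Definition outdegrees (p : nat -> nat) (n : nat) : seq nat :=
  sort geq [seq outdeg p v | v : 'I_n].

(* The k largest ones; the value is 0 beyond the n-th one, when n < k.          *)
Definition top_eigenvalue (R : realType) (p : nat -> nat) (n i : nat) : R :=
  nth 0 (eigenvalues (adjmx R p n)) i.

Definition top_outdeg (p : nat -> nat) (n i : nat) : nat :=
  nth 0%N (outdegrees p n) i.

Definition attach_prob (R : realType) (a : R) (p : nat -> nat) (n : nat)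
    (v : 'I_n) : R :=
  ((outdeg p v)%:R + 1 + a) / \sum_(u < n) ((outdeg p u)%:R + 1 + a).

Section Process.
Context d (Omega : measurableType d) (R : realType) (P : probability Omega R).

(* The event that the trees up to the n-th one are those encoded by h.          *)
Definition history (par : nat -> {RV P >-> nat}) (n : nat) (h : nat -> nat) :
    set Omega :=
  [set w | forall m, (0 < m < n)%N -> par m w = h m].

(* par n is the parent of the vertex n, which is added to the n-th tree. The    *)
(* conditional law of par n given the past is written in product form.          *)
Definition linear_pref_attachment (a : R) (par : nat -> {RV P >-> nat}) : Prop :=
  (forall (n : nat) (w : Omega), (0 < n)%N -> (par n w < n)%N) /\
  (forall (n : nat) (h : nat -> nat) (v : 'I_n),
     P (history par n h `&` par n @^-1` [set val v]) =
     (P (history par n h) * (attach_prob a h v)%:E)%E).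

End Process.

(* Convergence in distribution of random vectors of R^k, possibly defined on    *)
(* different probability spaces.                                                *)
Definition cvg_in_distribution (R : realType) (k : nat)
    (d : measure_display) (T : measurableType d) (P : probability T R)
    (Y : nat -> T -> 'rV[R]_k)
    (d' : measure_display) (T' : measurableType d') (P' : probability T' R)
    (Z : T' -> 'rV[R]_k) : Prop :=
  forall f : 'rV[R]_k -> R, continuous f -> bounded_fun f ->
    'E_P[f \o Y n]%E @[n --> \oo] --> 'E_P'[f \o Z]%E.

(* Main.v *)
(* On a tree, the edges from the first t vertices to the later ones form
   disjoint stars, whose adjacency matrix has eigenvalues +-sqrt of the star
   sizes; the remaining edges form a graph of norm at most 2 sqrt m, where m
   bounds t and the degrees of the vertices born after t. Hence
   |lambda_i - sqrt Delta_i| = O(sqrt m), by the min-max principle.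

   For the degrees, with c = 1 + a, the weight of a vertex grows as an urn: for
   every s > -c, the function prod_(i < D) (1 + s / (i + c)) of the outdegree,
   which is of order D^s, has an expectation that is multiplied at time n by
   1 + s / (gamma n - 1), and so is of order n^(s / gamma).
   - A large s and Borel-Cantelli bound the degrees of the vertices born after
     t = n^(1 / 2 gamma) by n^(1 / gamma - eta).
   - s = 1 gives a martingale, and s = 2 its variance; along a polynomial
     subsequence of times, its increments are summable for all vertices born
     before t at once, so that Delta_i / n^(1 / gamma) converges almost surely
     along this subsequence, and along all times because Delta_i is monotone.
   - s < 0 and Fatou's lemma show that the limits do not vanish. *)
Require Import Defs.
From HB Require Import structures.
From mathcomp Require Import all_boot all_order all_algebra.
From mathcomp Require Import all_classical all_reals all_analysis.
From mathcomp Require Import measurable_realfun polyrcf complex zify ring lra.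

Set Implicit Arguments.
Unset Strict Implicit.
Unset Printing Implicit Defensive.

Import Order.TTheory GRing.Theory Num.Theory.
Import numFieldNormedType.Exports.

Local Open Scope ring_scope.

(** * The real spectral theorem *)

(** Convergence of each single degree would not be enough: the vertices carrying the top degrees may
    change with [n], and infinitely many compete. Order statistics are 1-Lipschitz for the sup norm
    of the degree vector, so the changes of all degrees are bounded uniformly, and no limiting
    maximiser has to be identified. The exponents, with [th = 1 / gamma]: a vertex born at time
    [n ^ (th / 2)] has degree about [n ^ (th - th ^ 2 / 2)]. Half of this gain is kept as
    [eta = th ^ 2 / 4], the other half pays for the moment bound. The vertices born earlier number
    only [n ^ (th / 2)], while their increments have variance of order [n ^ (- th)], so the sum over
    them is still small along a polynomial subsequence. Conditional expectations never appear as
    such: what happens up to time [n] depends on finitely many parents, expectations are finite sums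
    over histories, and the martingale property is a recurrence between such sums. Convergence in
    distribution comes from almost sure convergence on the given probability space, which also
    carries the limits. *)

Lemma mulmx_trmx_eq0 (R : realDomainType) (n : nat) (x : 'rV[R]_n) :
  ((x *m x^T) 0 0 == 0) = (x == 0).
Proof.
apply/idP/eqP => [|->]; last by rewrite mul0mx mxE.
rewrite mxE psumr_eq0 => [/allP h|i _]; last by rewrite mxE -expr2 sqr_ge0.
apply/rowP => i; have := h i (mem_index_enum _); rewrite !mxE -expr2 sqrf_eq0.
by move/eqP.
Qed.

(** The characteristic polynomial has a root [z] over the complex numbers. For an eigenvector [v],
    the number [v B conj(v)^T] equals its own conjugate because [B] is real symmetric, and it is [z]
    times a positive number; hence [z] is real. *)
Lemma sym_eigenvalue (R : rcfType) (n : nat) (A : 'M[R]_n.+1) :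
  A^T = A -> exists a, eigenvalue A a.
Proof.
move=> symA; pose B := map_mx (real_complex R) A.
have [z rz] : exists z, root (char_poly B) z.
  by apply/closed_rootP; rewrite size_char_poly.
have : eigenvalue B z by rewrite eigenvalue_root_char.
case/eigenvalueP => v vB vN0.
pose w := (map_mx Num.conj v)^T.
pose s := (v *m w) 0 0.
have s_gt0 : 0 < s.
  have sE : s = \sum_j `|v 0 j| ^+ 2.
    by rewrite /s mxE; apply: eq_bigr => j _; rewrite !mxE normCK.
  rewrite lt_neqAle sE sumr_ge0 ?andbT => [|j _]; last by rewrite exprn_ge0.
  apply: contra vN0; rewrite eq_sym psumr_eq0 => [/allP h|j _]; last first.
    by rewrite exprn_ge0.
  apply/eqP/rowP => i; have := h i (mem_index_enum _).
  by rewrite !mxE sqrf_eq0 normr_eq0 => /eqP.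
pose q := (v *m B *m w) 0 0.
have qE : q = z * s by rewrite /q vB -scalemxAl mxE.
have conjB : map_mx Num.conj B = B.
  by apply/matrixP => i j; rewrite !mxE; apply/CrealP/complex_realP; exists (A i j).
have symB : B^T = B by apply/matrixP => i j; rewrite !mxE -[in LHS]symA mxE.
have conjq : Num.conj q = q.
  have -> : Num.conj q = ((map_mx Num.conj (v *m B *m w))^T) 0 0.
    by rewrite [RHS]mxE [RHS]mxE.
  have wE : (map_mx Num.conj w)^T = v.
    by apply/matrixP => i j; rewrite !mxE conjCK.
  by rewrite !map_mxM !trmx_mul conjB symB wE mulmxA.
have conjs : Num.conj s = s by apply/CrealP/ger0_real/ltW.
have zr : z \is Num.real.
  apply/CrealP; apply: (mulIf (lt0r_neq0 s_gt0)).
  by rewrite -[in LHS]conjs -rmorphM -qE.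
case/complex_realP: zr => a za; exists a.
rewrite eigenvalue_root_char; move: rz; rewrite za /B -map_char_poly.
by rewrite fmorph_root.
Qed.

(** [Q] is the Householder reflection in the hyperplane orthogonal to [x - e], which exchanges [x]
    and the first basis vector [e]. It is undefined for [x = e], where the identity serves. *)
Lemma orthogonal_completion (R : rcfType) (n : nat) (x : 'rV[R]_n.+1) :
  x *m x^T = 1 -> exists2 Q : 'M[R]_n.+1, Q *m Q^T = 1%:M & row 0 Q = x.
Proof.
move=> xx; pose e : 'rV[R]_n.+1 := delta_mx 0 0.
have eM m (M : 'M[R]_(n.+1, m)) : e *m M = row 0 M by rewrite rowE.
have ee : e *m e^T = 1.
  by rewrite eM; apply/rowP => i; rewrite !mxE !ord1 eqxx.
have [->|xNe] := eqVneq x e.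
  by exists 1%:M; rewrite ?trmx1 ?mulmx1 // row1.
pose w := x - e; pose s := (w *m w^T) 0 0.
have sN0 : s != 0 by rewrite mulmx_trmx_eq0 subr_eq0.
have ww : w *m w^T = s%:M by rewrite [LHS]mx11_scalar.
pose Q := 1%:M - (2 / s) *: (w^T *m w).
have QT : Q^T = Q by rewrite /Q linearB linearZ /= trmx1 trmx_mul trmxK.
have xe : (x *m e^T) 0 0 = x 0 0.
  rewrite mxE (bigD1 0) //= big1 => [|j jN0]; last first.
    by rewrite !mxE (negPf jN0) mulr0.
  by rewrite !mxE eqxx mulr1 addr0.
have ex : e *m x^T = x *m e^T.
  by rewrite -[LHS]trmxK trmx_mul trmxK; apply/matrixP => i j; rewrite mxE !ord1.
have sE : s = 2 - 2 * x 0 0.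
  rewrite /s /w linearB /= mulmxBl !mulmxBr xx ee ex.
  rewrite !mxE /= in xe *; rewrite xe; ring.
exists Q.
  pose P := w^T *m w.
  have PP : P *m P = s *: P.
    by rewrite mulmxA -(mulmxA w^T) ww mul_mx_scalar -scalemxAl.
  rewrite QT /Q mulmxBr mulmx1 mulmxBl mul1mx -!scalemxAl -!scalemxAr PP.
  rewrite !scalerA (_ : 2 / s * (2 / s) * s = 2 / s + 2 / s); last by field.
  by rewrite scalerDl opprB addrK addrNK.
rewrite -eM /Q mulmxBr mulmx1 -scalemxAr mulmxA.
have -> : e *m w^T = (x 0 0 - 1)%:M.
  rewrite /w linearB /= mulmxBr ee ex [x *m _]mx11_scalar xe.
  by apply/matrixP => i j; rewrite !mxE !ord1 eqxx.
rewrite mul_scalar_mx scalerA -scaleNr.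
have -> : - (2 / s * (x 0 0 - 1)) = 1 by rewrite sE in sN0 *; field.
by rewrite scale1r /w addrC subrK.
Qed.

(** Deflation: in an orthonormal basis starting with a unit eigenvector, the first row of [A] is [a]
    times a basis vector, by symmetry so is the first column, and the induction hypothesis applies
    to the remaining block. *)
Theorem sym_spectral (R : rcfType) (n : nat) (A : 'M[R]_n) : A^T = A ->
  exists (U : 'M[R]_n) (d : 'rV[R]_n),
    U *m U^T = 1%:M /\ A = U^T *m diag_mx d *m U.
Proof.
elim: n A => [|n IHn] A symA.
  exists 1%:M, 0; split; last by rewrite [A]flatmx0 [RHS]flatmx0.
  by rewrite trmx1 mulmx1.
have [a /eigenvalueP[y yA yN0]] := sym_eigenvalue symA.
pose s := (y *m y^T) 0 0.
have s_gt0 : 0 < s.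
  rewrite lt_neqAle eq_sym mulmx_trmx_eq0 yN0 /s mxE sumr_ge0 // => i _.
  by rewrite mxE -expr2 sqr_ge0.
pose x := (Num.sqrt s)^-1 *: y.
have xA : x *m A = a *: x by rewrite -scalemxAl yA scalerA mulrC -scalerA.
have xx : x *m x^T = 1.
  rewrite linearZ /= -scalemxAr -scalemxAl scalerA [y *m _]mx11_scalar -/s.
  rewrite -invfM -expr2 sqr_sqrtr ?ltW // scale_scalar_mx mulVf //.
  by rewrite gt_eqF.
have [Q QQ Qx] := orthogonal_completion xx.
have QQ' : Q^T *m Q = 1%:M by apply: mulmx1C.
have [B BQ] : exists B : 'M[R]_(1 + n), B = Q *m A *m Q^T by eexists.
have symB : B^T = B by rewrite BQ !trmx_mul trmxK symA mulmxA.
have B0 : row 0 B = a *: delta_mx 0 0.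
  by rewrite BQ !row_mul Qx xA -scalemxAl -Qx -row_mul QQ row1.
have Bul : ulsubmx B = a%:M.
  apply/matrixP => i j; have /rowP/(_ (lshift n j)) := B0.
  by rewrite !ord1 !mxE !lshift0 eqxx mulr1 => <-.
have Bur : ursubmx B = 0.
  apply/matrixP => i j; have /rowP/(_ (rshift 1 j)) := B0.
  by rewrite !ord1 !mxE !lshift0 mulr0 => <-.
have Bdl : dlsubmx B = 0 by rewrite -symB -trmx_ursub Bur trmx0.
have symB' : (drsubmx B)^T = drsubmx B by rewrite trmx_drsub symB.
have [U [d [UU BE]]] := IHn _ symB'.
pose V : 'M[R]_(1 + n) := block_mx 1%:M 0 0 U.
have VT : V^T = block_mx 1%:M 0 0 U^T by rewrite /V tr_block_mx !trmx0 trmx1.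
have VV : V *m V^T = 1%:M.
  rewrite VT mulmx_block !mulmx0 !mul0mx mulmx1 UU !addr0 !add0r.
  by rewrite -scalar_mx_block.
pose d' : 'rV[R]_(1 + n) := row_mx a%:M d.
have d'E : diag_mx d' = block_mx (diag_mx a%:M) 0 0 (diag_mx d).
  by rewrite /d' diag_mx_row.
have BV : B = V^T *m diag_mx d' *m V.
  rewrite VT d'E /V !mulmx_block -[LHS]submxK Bul Bur Bdl BE.
  rewrite !mulmx0 !mul0mx !addr0 !add0r !mul1mx !mulmx1 mul0mx.
  by congr block_mx; apply/matrixP => i j; rewrite !mxE !ord1 eqxx.
exists (V *m Q), d'; split.
  by rewrite trmx_mul mulmxA -(mulmxA V) QQ mulmx1.
have -> : A = Q^T *m B *m Q.
  by rewrite BQ -!mulmxA QQ' mulmx1 !mulmxA QQ' mul1mx.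
by rewrite BV trmx_mul !mulmxA.
Qed.

Lemma char_poly_spectral (R : rcfType) (n : nat) (U : 'M[R]_n) (d : 'rV[R]_n) :
  U *m U^T = 1%:M ->
  char_poly (U^T *m diag_mx d *m U) = \prod_i ('X - (d 0 i)%:P).
Proof.
move=> UU; have UU' : U^T *m U = 1%:M by apply: mulmx1C.
have -> : char_poly (U^T *m diag_mx d *m U) = char_poly (diag_mx d).
  rewrite /char_poly /char_poly_mx.
  have XE : 'X%:M = map_mx polyC U^T *m ('X%:M : 'M[{poly R}]_n) *m map_mx polyC U.
    by rewrite mul_mx_scalar -scalemxAl -map_mxM UU' map_mx1 scalemx1.
  rewrite {1}XE !map_mxM -mulmxBl -mulmxBr !det_mulmx mulrAC -det_mulmx -map_mxM.
  by rewrite UU' map_mx1 det1 mul1r.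
rewrite char_poly_trig ?diag_mx_is_trig //.
by apply: eq_bigr => i _; rewrite mxE eqxx.
Qed.

(** * Ordered eigenvalues and the min-max principle *)

Definition kth_largest (R : realDomainType) (s : seq R) (i : nat) : R :=
  nth 0 (sort >=%R s) i.

(** Every comparison of an order statistic with a level is reduced to counting the entries beyond
    that level, so that sorting is dealt with only here. In a nonincreasing list, the entries of an
    upward closed [P] form a prefix. *)
Lemma kth_largest_count (R : realDomainType) (P : pred R) (s : seq R) (i : nat) :
  (forall x y, x <= y -> P x -> P y) -> (i < size s)%N ->
  P (kth_largest s i) = (i < count P s)%N.
Proof.
move=> Pup; rewrite /kth_largest.
have /permP <- : perm_eq (sort >=%R s) s by rewrite perm_sort.
rewrite -(size_sort >=%R s).
have : sorted >=%R (sort >=%R s) by apply: sort_sorted => x y; exact: le_total.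
elim: (sort >=%R s) i => [|y t IH] // [|i] /=.
  move=> pt _; case Py: (P y); first by rewrite addnC addn1.
  rewrite add0n; apply/esym/negbTE; rewrite -leqNgt leqn0 -leqn0 leqNgt -has_count.
  apply/hasPn => z zt; apply: contraFN Py; apply: Pup.
  by have /allP/(_ _ zt) := order_path_min (@ge_trans _ _) pt.
move=> pt it; have {IH} := IH i (path_sorted pt) it.
move=> ->; case Py: (P y) => //; rewrite add0n.
apply/idP/idP => [h|/ltnW //]; exfalso.
have /hasP[z zt Pz] : has P t by rewrite has_count (leq_trans _ h).
have : P y.
  by apply: Pup Pz; have /allP/(_ _ zt) := order_path_min (@ge_trans _ _) pt.
by rewrite Py.
Qed.

Lemma kth_largest_perm (R : realDomainType) (s t : seq R) :
  perm_eq s t -> kth_largest s =1 kth_largest t.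
Proof.
move=> st i; congr (nth 0 _ i); apply/perm_sortP => //.
- by move=> x y; exact: le_total.
- exact: ge_trans.
- exact: ge_anti.
Qed.

(** If [x] is the value for [f], then more than [i] entries of [f] are at least [x], and the same
    entries of [g] are at least [x - e]. For [i] out of range both values are the default [0], and
    the claim is [0 <= e]. *)
Lemma kth_largest_le (R : realDomainType) (T : eqType) (r : seq T)
    (f g : T -> R) (e : R) (i : nat) : 0 <= e ->
  (forall v, v \in r -> f v <= g v + e) ->
  kth_largest (map f r) i <= kth_largest (map g r) i + e.
Proof.
move=> e0 fg; have [ir|ri] := ltnP i (size r); last first.
  by rewrite /kth_largest !nth_default ?size_sort ?size_map ?add0r.
have := lexx (kth_largest (map f r) i).
set x := {1}(kth_largest _ _).
rewrite (@kth_largest_count _ (>= x)) ?size_map // => [h|y z yz xy]; last first.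
  exact: le_trans yz.
rewrite -lerBlDr (@kth_largest_count _ (>= (x - e))) ?size_map //; last first.
  by move=> y z yz xy; exact: le_trans yz.
apply: leq_trans h _; rewrite !count_map.
rewrite -(@eq_in_count _ [predI (fun v => x <= f v) & mem r]) => [|v /= ->]; last first.
  by rewrite andbT.
rewrite -[leqRHS](@eq_in_count _ [predI (fun v => x - e <= g v) & mem r]) => [|v /= ->]; last first.
  by rewrite andbT.
apply: sub_count => v /= /andP[xf vr]; rewrite vr andbT unfold_in lerBlDr.
rewrite unfold_in in xf.
by apply: le_trans xf _; exact: fg.
Qed.

Lemma kth_largest_lipschitz (R : realDomainType) (T : eqType) (r : seq T)
    (f g : T -> R) (e : R) (i : nat) : 0 <= e ->
  (forall v, v \in r -> `|f v - g v| <= e) ->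
  `|kth_largest (map f r) i - kth_largest (map g r) i| <= e.
Proof.
move=> e0 fg; rewrite ler_distl lerBlDr !kth_largest_le // => v /fg.
  by rewrite distrC ler_distl lerBlDr => /andP[].
by rewrite ler_distl lerBlDr => /andP[].
Qed.

(** Zeros sort behind nonnegative entries, where they agree with the default value of [nth]. *)
Lemma kth_largest_pad (R : realDomainType) (s t : seq R) (i : nat) :
  all (>= 0) s -> all (pred1 0) t -> kth_largest (s ++ t) i = kth_largest s i.
Proof.
move=> s0 /all_pred1P ->; rewrite /kth_largest.
suff -> : sort >=%R (s ++ nseq (size t) 0) = sort >=%R s ++ nseq (size t) 0.
  rewrite nth_cat; case: ifP => // /negbT; rewrite -leqNgt => h.
  by rewrite nth_nseq if_same nth_default.
apply: (@sorted_eq _ >=%R); first exact: ge_trans.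
- exact: ge_anti.
- by apply: sort_sorted => x y; exact: le_total.
- rewrite (sorted_pairwise (@ge_trans _ _)) pairwise_cat.
  rewrite -!(sorted_pairwise (@ge_trans _ _)) sort_sorted => [|x y]; last first.
    exact: le_total.
  apply/and3P; split=> //; last first.
    by rewrite (sorted_pairwise (@ge_trans _ _)); 
    elim: (size t) => //= m ->; rewrite all_nseq /= lexx orbT.
  apply/allrelP => x y; rewrite mem_sort => xs; rewrite mem_nseq => /andP[_ /eqP ->].
  exact: (allP s0).
- by rewrite perm_sort perm_sym perm_cat2r perm_sort.
Qed.

Lemma kth_largestZ (R : realDomainType) (s : seq R) (a : R) (i : nat) :
  0 < a -> kth_largest [seq a * x | x <- s] i = a * kth_largest s i.
Proof.
move=> a0; rewrite /kth_largest -(map_sort (leT' := >=%R)) => [|x y].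
  have [h|h] := ltnP i (size (sort >=%R s)); first by rewrite (nth_map 0).
  by rewrite !nth_default ?size_map ?mulr0.
by rewrite /= ler_pM2l.
Qed.

Lemma top_outdegE (R : realType) (p : nat -> nat) (n i : nat) :
  (top_outdeg p n i)%:R =
  kth_largest [seq (outdeg p v)%:R | v <- enum 'I_n] i :> R.
Proof.
rewrite /top_outdeg /outdegrees /kth_largest map_comp -(map_sort (leT' := geq)).
  have [h|h] := ltnP i (size (sort geq [seq outdeg p v | v <- enum 'I_n])).
    by rewrite (nth_map 0%N).
  by rewrite !nth_default ?size_map.
by move=> x y; rewrite /= ler_nat.
Qed.

(** The multiplicity of [y] as a root is both the number of its copies in the flattened list and the
    number of its occurrences in [d]. *)
Lemma eigenvaluesE (R : realType) (n : nat) (A : 'M[R]_n) (d : seq R) (i : nat) :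
  char_poly A = \prod_(x <- d) ('X - x%:P) ->
  nth 0 (eigenvalues A) i = kth_largest d i.
Proof.
move=> chA; apply: kth_largest_perm; rewrite chA.
set p := \prod_(x <- d) _.
have p0 : p != 0 by rewrite monic_neq0 // monic_prod_XsubC.
have urs : uniq (rootsR p) by apply: lt_sorted_uniq; exact: sorted_roots.
apply/allP => y _ /=; apply/eqP.
rewrite count_flatten -map_comp sumnE big_map -mu_prod_XsubC -/p.
transitivity (\sum_(x <- rootsR p) (if x == y then mup x p else 0))%N.
  by apply: eq_bigr => x _ /=; rewrite count_nseq /=; case: eqP; rewrite ?mul1n ?mul0n.
rewrite -big_mkcond -big_filter.
have [yr|yr] := boolP (y \in rootsR p).
  have := filter_pred1_uniq urs yr. 
  rewrite (eq_filter (a2 := pred1 y)) // => ->.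
  by rewrite big_seq1.
rewrite (eq_in_filter (a2 := pred0)) ?filter_pred0 ?big_nil => [|x xr]; last first.
  by apply: contraNF yr => /eqP <-.
rewrite mupNroot //; have := roots_on_rootsR p0 y.
by rewrite (negbTE yr) inE /= => ->.
Qed.

(** Dimension count: the [#|S|] linear conditions have a nonzero solution on a space of larger
    dimension. Using [row_base V] makes the parametrisation injective, so that the solution gives a
    nonzero vector of [V]. *)
Lemma exists_vanishing_vector (F : fieldType) (m n : nat) (S : {set 'I_n}) (V : 'M[F]_(m, n))
    (U : 'M[F]_n) : (#|S| < \rank V)%N ->
  exists x : 'rV[F]_n, [/\ x != 0, (x <= V)%MS & forall j, j \in S -> (x *m U) 0 j = 0].
Proof.
move=> SV; pose W := \matrix_(k < n, l < #|S|) U k (enum_val l).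
pose M := row_base V *m W.
have : kermx M != 0.
  rewrite -mxrank_eq0 mxrank_ker subn_eq0 -ltnNge.
  by apply: leq_ltn_trans SV; exact: rank_leq_col.
case/rowV0Pn => y /sub_kermxP yM yN0; exists (y *m row_base V); split.
- by rewrite mulmx_free_eq0 // row_base_free.
- by apply: submx_trans (submxMl _ _) _; rewrite eq_row_base.
move=> j jS; have /rowP/(_ (enum_rank_in jS j)) := yM.
rewrite [RHS]mxE mulmxA => <-; rewrite !mxE; apply: eq_bigr => l _.
by rewrite !mxE enum_rankK_in.
Qed.

Lemma count_enum (n : nat) (P : pred 'I_n) :
  count P (enum 'I_n) = #|[set j | P j]|.
Proof. by rewrite cardsE cardE -size_filter enumT [in RHS]/enum_mem. Qed.

Section MinMax.
Variables (R : realType) (n : nat) (A : 'M[R]_n) (m : nat) (V : 'M[R]_(m, n)).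
Hypothesis symA : A^T = A.

Lemma spectral_form (U : 'M[R]_n) (d x : 'rV[R]_n) : U *m U^T = 1%:M ->
  A = U^T *m diag_mx d *m U ->
  (x *m x^T) 0 0 = \sum_j (x *m U^T) 0 j ^+ 2 /\
  (x *m A *m x^T) 0 0 = \sum_j d 0 j * (x *m U^T) 0 j ^+ 2.
Proof.
move=> UU AE; have UU' : U^T *m U = 1%:M by apply: mulmx1C.
split.
  have -> : x *m x^T = (x *m U^T) *m (x *m U^T)^T.
    by rewrite trmx_mul trmxK mulmxA -(mulmxA x) UU' mulmx1.
  by rewrite mxE; apply: eq_bigr => j _; rewrite [X in _ * X]mxE.
have -> : x *m A *m x^T = (x *m U^T) *m diag_mx d *m (x *m U^T)^T.
  by rewrite AE trmx_mul trmxK !mulmxA.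
rewrite mxE; apply: eq_bigr => j _; rewrite mul_mx_diag [X in _ * X]mxE.
by rewrite [X in X * _]mxE mulrAC mulrC expr2.
Qed.

(** If at most [i] eigenvalues were [>= mu], some nonzero vector of [V] would have no component
    along their eigenvectors. Its form would then be a combination of eigenvalues [< mu] only,
    against the hypothesis on [V]. *)
Lemma eigenvalue_ge (mu : R) (i : nat) : (i < \rank V)%N ->
  (forall x : 'rV_n, (x <= V)%MS -> mu * (x *m x^T) 0 0 <= (x *m A *m x^T) 0 0) ->
  mu <= nth 0 (eigenvalues A) i.
Proof.
move=> iV VA; have [U [d [UU AE]]] := sym_spectral symA.
have inn : (i < n)%N by apply: leq_trans iV (rank_leq_col V).
rewrite (@eigenvaluesE _ _ _ [seq d 0 j | j <- enum 'I_n]); last first.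
  by rewrite AE char_poly_spectral // big_map big_enum.
rewrite (@kth_largest_count _ (>= mu)) ?size_map -?enumT ?size_enum_ord //; last first.
  by move=> y z yz xy; exact: le_trans yz.
rewrite ltnNge; apply/negP => ci.
have [|x [xN0 xV x0]] := @exists_vanishing_vector _ _ _ [set j | mu <= d 0 j] V U^T.
  apply: leq_ltn_trans iV; by move: ci; rewrite count_map count_enum.
have := VA x xV; have [-> ->] := spectral_form x UU AE.
rewrite mulr_sumr leNgt => /negP; apply.
have xUN0 : x *m U^T != 0.
  apply: contra xN0 => /eqP xU; have UU' : U^T *m U = 1%:M by apply: mulmx1C.
  by rewrite -[x]mulmx1 -UU' mulmxA xU mul0mx.
have /existsP[k kN0] : [exists k, (x *m U^T) 0 k != 0].
  rewrite -negb_forall; apply: contra xUN0 => /forallP h.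
  by apply/eqP/rowP => k; rewrite [RHS]mxE; exact/eqP.
(* The strictness comes from the coordinate [k]: it does not vanish, so its eigenvalue is [< mu]. *)
rewrite (bigD1 k) //= [ltRHS](bigD1 k) //= ltr_leD //.
  rewrite ltr_pM2r ?exprn_even_gt0 // ltNge; apply: contra kN0 => h.
  by rewrite x0 // inE.
apply: ler_sum => j _; have [h|h] := leP mu (d 0 j).
  by rewrite x0 ?inE // expr0n /= !mulr0.
by rewrite ler_wpM2r ?sqr_ge0 // ltW.
Qed.

Lemma eigenvalue_le (mu : R) (i : nat) : (i < n)%N -> (n - i <= \rank V)%N ->
  (forall x : 'rV_n, (x <= V)%MS -> (x *m A *m x^T) 0 0 <= mu * (x *m x^T) 0 0) ->
  nth 0 (eigenvalues A) i <= mu.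
Proof.
move=> inn iV VA; have [U [d [UU AE]]] := sym_spectral symA.
rewrite (@eigenvaluesE _ _ _ [seq d 0 j | j <- enum 'I_n]); last first.
  by rewrite AE char_poly_spectral // big_map big_enum.
rewrite leNgt (@kth_largest_count _ (> mu)) ?size_map -?enumT ?size_enum_ord //; last first.
  by move=> y z yz xy; exact: lt_le_trans yz.
apply/negP => ci.
have [|x [xN0 xV x0]] := @exists_vanishing_vector _ _ _ [set j | d 0 j <= mu] V U^T.
  apply: leq_trans iV; have := count_predC (> mu) [seq d 0 j | j <- enum 'I_n].
  rewrite size_map -?enumT size_enum_ord.
  rewrite (_ : count (predC (> mu)) _ = #|[set j | d 0 j <= mu]|); last first.
    rewrite count_map count_enum; congr #|pred_of_set _|.
    by apply/setP => j; rewrite !inE /= -leNgt.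
  by move=> h; rewrite ltn_subRL -[ltnRHS]h ltn_add2r.
have := VA x xV; have [-> ->] := spectral_form x UU AE.
rewrite mulr_sumr leNgt => /negP; apply.
have xUN0 : x *m U^T != 0.
  apply: contra xN0 => /eqP xU; have UU' : U^T *m U = 1%:M by apply: mulmx1C.
  by rewrite -[x]mulmx1 -UU' mulmxA xU mul0mx.
have /existsP[k kN0] : [exists k, (x *m U^T) 0 k != 0].
  rewrite -negb_forall; apply: contra xUN0 => /forallP h.
  by apply/eqP/rowP => k; rewrite [RHS]mxE; exact/eqP.
rewrite (bigD1 k) //= [ltRHS](bigD1 k) //= ltr_leD //.
  rewrite ltr_pM2r ?exprn_even_gt0 // ltNge; apply: contra kN0 => h.
  by rewrite x0 // inE.
apply: ler_sum => j _; have [h|h] := leP (d 0 j) mu.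
  by rewrite x0 ?inE // expr0n /= !mulr0.
by rewrite ler_wpM2r ?sqr_ge0 // ltW.
Qed.

End MinMax.

(** * Spectrum of a tree with few large degrees *)

Definition recursive_tree (p : nat -> nat) :=
  forall m, (0 < m)%N -> (p m < m)%N.

Lemma card_ord_lt (n t : nat) : (#|[pred v : 'I_n | (v < t)%N]| <= t)%N.
Proof.
rewrite -[leqRHS](size_iota 0) cardE -(size_map val); apply: uniq_leq_size.
  by rewrite map_inj_uniq ?enum_uniq //; exact: val_inj.
by move=> _ /mapP[v + ->]; rewrite mem_enum inE mem_iota.
Qed.

Section TreeSpectrum.
Variables (R : realType) (p : nat -> nat) (n : nat).
Hypothesis hp : recursive_tree p.
Implicit Types (u v : 'I_n) (x : 'rV[R]_n).

Lemma tree_edge_lt u v : tree_edge p u v -> (u < v)%N.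
Proof. by case/andP => v0 /eqP <-; exact: hp. Qed.

Lemma tree_edge_parent u u' v : tree_edge p u v -> tree_edge p u' v -> u = u'.
Proof. by move=> /andP[_ /eqP e] /andP[_ /eqP e']; apply: val_inj; exact: etrans (esym e) e'. Qed.

Lemma adjmx_sym : (adjmx R p n)^T = adjmx R p n.
Proof. by apply/matrixP => u v; rewrite !mxE orbC. Qed.

(** Labels increase along edges, so the two orientations of an edge exclude each other and the
    disjunction in [adjmx] is a sum. *)
Lemma adjmx_form x : (x *m adjmx R p n *m x^T) 0 0 =
  2 * \sum_u \sum_(v | tree_edge p u v) x 0 u * x 0 v.
Proof.
have E u v : adjmx R p n u v = (tree_edge p u v)%:R + (tree_edge p v u)%:R.
  rewrite mxE; have := @tree_edge_lt u v; have := @tree_edge_lt v u.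
  case: (tree_edge p u v); case: (tree_edge p v u) => //= h1 h2; rewrite ?addr0 ?add0r //.
  by have := ltn_trans (h1 isT) (h2 isT); rewrite ltnn.
have S : \sum_v \sum_u x 0 u * (tree_edge p u v)%:R * x 0 v =
         \sum_u \sum_(v | tree_edge p u v) x 0 u * x 0 v.
  rewrite exchange_big; apply: eq_bigr => u _; rewrite [RHS]big_mkcond /=.
  by apply: eq_bigr => v _; case: ifP; rewrite ?mulr1 // mulr0 mul0r.
rewrite mxE; under eq_bigr => v _.
  rewrite mxE big_distrl /= mxE; under eq_bigr => u _ do rewrite E mulrDr mulrDl.
  rewrite big_split /=.
  over.
rewrite big_split /= S mulr_natl mulr2n; congr (_ + _).
rewrite exchange_big -S; apply: eq_bigr => v _; apply: eq_bigr => u _.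
by rewrite mulrC mulrA mulrAC.
Qed.

(** A vertex has at most one parent, hence is the lower end of at most one edge of [F]. *)
Lemma edge_sum_le (F : rel 'I_n) (P : pred 'I_n) (G : 'I_n -> R) :
  (forall u v, F u v -> tree_edge p u v) -> (forall u v, F u v -> P v) ->
  (forall v, 0 <= G v) ->
  \sum_u \sum_(v | F u v) G v <= \sum_(v | P v) G v.
Proof.
move=> Fe FP G0; rewrite (exchange_big_dep predT) //= [leRHS]big_mkcond /=.
apply: ler_sum => v _; have [/existsP[u Fuv]|/existsPn h] := boolP [exists u, F u v].
  rewrite (FP _ _ Fuv) (bigD1 u) //= big1 ?addr0 // => u' /andP[/Fe h /eqP[]].
  exact: tree_edge_parent h (Fe _ _ Fuv).
by rewrite big1 => [|u Fuv]; [case: ifP | have := h u; rewrite Fuv].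
Qed.

(* AM-GM on each edge, with weights balancing the [kappa] children of a vertex
   against its single parent. *)
Lemma edge_form_le (F : rel 'I_n) (P Q : pred 'I_n) (kappa : R) x :
  (forall u v, F u v -> tree_edge p u v) ->
  (forall u v, F u v -> P u) -> (forall u v, F u v -> Q v) ->
  (forall u, #|[pred v | F u v]|%:R <= kappa) ->
  `|2 * \sum_u \sum_(v | F u v) x 0 u * x 0 v| <=
  Num.sqrt kappa * (\sum_(u | P u) x 0 u ^+ 2 + \sum_(v | Q v) x 0 v ^+ 2).
Proof.
move=> Fe FP FQ Fk.
have S0 (T : pred 'I_n) : 0 <= \sum_(u | T u) x 0 u ^+ 2.
  by apply: sumr_ge0 => u _; exact: sqr_ge0.
have [k0|k0] := leP kappa 0.
  rewrite [X in 2 * X]big1 ?mulr0 ?normr0 ?mulr_ge0 ?sqrtr_ge0 ?addr_ge0 // => u _.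
  rewrite big1 // => v Fuv; have := le_trans (Fk u) k0.
  by rewrite lern0 => /eqP/card0_eq/(_ v); rewrite inE Fuv.
have s0 : 0 < Num.sqrt kappa by rewrite sqrtr_gt0.
have ss : Num.sqrt kappa * Num.sqrt kappa = kappa by rewrite -expr2 sqr_sqrtr ?ltW.
set s := Num.sqrt kappa in s0 ss *.
have am (a b : R) : `|2 * (a * b)| <= a ^+ 2 / s + s * b ^+ 2.
  have -> : a ^+ 2 / s + s * b ^+ 2 = (a ^+ 2 + kappa * b ^+ 2) / s.
    by rewrite mulrDl -ss; field; rewrite gt_eqF.
  rewrite ler_pdivlMr // -[X in _ * X <= _](gtr0_norm s0) -normrM ler_norml.
  have h1 := sqr_ge0 (a - s * b); have h2 := sqr_ge0 (a + s * b).
  rewrite -ss; apply/andP; split; nra.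
apply: (@le_trans _ _ (\sum_u \sum_(v | F u v) (x 0 u ^+ 2 / s + s * x 0 v ^+ 2))).
  rewrite mulr_sumr; apply: le_trans (ler_norm_sum _ _ _) _.
  apply: ler_sum => u _; rewrite mulr_sumr; apply: le_trans (ler_norm_sum _ _ _) _.
  by apply: ler_sum => v _; exact: am.
under eq_bigr => u _ do rewrite big_split /=.
rewrite big_split /= mulrDr; apply: lerD; last first.
  under eq_bigr => u _ do rewrite -mulr_sumr.
  rewrite -mulr_sumr ler_pM2l //; apply: edge_sum_le => // v; exact: sqr_ge0.
rewrite [leRHS]mulr_sumr [leRHS]big_mkcond /=; apply: ler_sum => u _.
case: ifP => Pu; last by rewrite big1 // => v /FP; rewrite Pu.
rewrite sumr_const -mulr_natl mulrCA [leRHS]mulrC ler_wpM2l ?sqr_ge0 //.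
by rewrite ler_pdivrMr // ss; exact: Fk.
Qed.

(** Source of both test spaces for the min-max principle: [r = 0] makes the coordinates in [S]
    vanish, and a general [r] ties each of them to another coordinate [q j]. One condition per
    element of [S] costs at most one dimension. *)
Lemma linear_conditions (S : {set 'I_n}) (r : 'I_n -> R) (q : 'I_n -> 'I_n) :
  exists V : 'M[R]_n, (n - #|S| <= \rank V)%N /\
    forall x, (x <= V)%MS -> forall j, j \in S -> x 0 j = r j * x 0 (q j).
Proof.
pose W := \matrix_(k < n, l < #|S|)
  ((k == enum_val l)%:R - r (enum_val l) * (k == q (enum_val l))%:R).
exists (kermx W); split.
  by rewrite mxrank_ker leq_sub2l // rank_leq_col.
move=> x /sub_kermxP /rowP xW j jS; have := xW (enum_rank_in jS j).
rewrite !mxE; under eq_bigr => k _ do rewrite mxE enum_rankK_in // mulrBr mulrCA.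
rewrite sumrB -mulr_sumr => /eqP; rewrite subr_eq0 => /eqP.
have D (i : 'I_n) : \sum_k x 0 k * (k == i)%:R = x 0 i.
  rewrite (bigD1 i) //= eqxx mulr1 big1 ?addr0 // => k /negbTE ->.
  by rewrite mulr0.
by rewrite !D.
Qed.

Variables (t : nat) (m : R).
Hypothesis tm : t%:R <= m.
Hypothesis outdeg_tail : forall u, (t <= u)%N -> (outdeg p u)%:R <= m.

Let star : rel 'I_n := [rel u v : 'I_n | [&& tree_edge p u v, (u < t)%N & (t <= v)%N]].
Let Delta (i : nat) : R := (top_outdeg p n i)%:R.

(** Outside the stars every vertex keeps at most [m] children: a vertex before [t] keeps only
    children before [t], at most [t <= m] of them, and a vertex from [t] on has small outdegree by
    assumption. *)
Lemma adjmx_form_star x :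
  `|(x *m adjmx R p n *m x^T) 0 0 - 2 * \sum_u \sum_(v | star u v) x 0 u * x 0 v|
  <= 2 * Num.sqrt m * (x *m x^T) 0 0.
Proof.
rewrite adjmx_form -mulrBr.
pose F : rel 'I_n := [rel u v : 'I_n | tree_edge p u v && ~~ star u v].
have -> : \sum_u \sum_(v | tree_edge p u v) x 0 u * x 0 v -
  \sum_u \sum_(v | star u v) x 0 u * x 0 v = \sum_u \sum_(v | F u v) x 0 u * x 0 v.
  rewrite -sumrB; apply: eq_bigr => u _; rewrite (bigID (star u)) /=.
  rewrite [X in X + _ - _](eq_bigl (star u)) => [|v]; last first.
    by rewrite /star /=; case: (tree_edge p u v).
  by rewrite addrAC subrr add0r.
have xx : (x *m x^T) 0 0 = \sum_u x 0 u ^+ 2.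
  by rewrite mxE; apply: eq_bigr => u _; rewrite mxE expr2.
have := @edge_form_le F predT predT m x.
move/(_ _ _ _ _)/le_trans; apply => //; first by move=> u v /andP[].
  move=> u; have [ut|tu] := ltnP u t.
    apply: le_trans tm; rewrite ler_nat.
    apply: (@leq_trans #|[pred v : 'I_n | (v < t)%N]|).
      apply: subset_leq_card; apply/fintype.subsetP => v; rewrite !inE => /andP[uv].
      by move: uv; rewrite /star /= ut /= => ->; rewrite -ltnNge.
    exact: card_ord_lt.
  apply: le_trans (outdeg_tail tu); rewrite ler_nat /outdeg; apply: subset_leq_card.
  by apply/fintype.subsetP => v; rewrite !inE => /andP[].
by rewrite xx -mulr2n -[X in _ * X <= _]mulr_natl mulrCA mulrA.
Qed.

(** Test space: vectors vanishing at the vertices of outdegree larger than [Delta i]. There are at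
    most [i] such vertices, and the stars around the others have at most [Delta i] leaves. *)
Lemma top_eigenvalue_le i : (i < n)%N ->
  top_eigenvalue R p n i <= Num.sqrt (Delta i) + 2 * Num.sqrt m.
Proof.
move=> inn.
pose T := [set u : 'I_n | Delta i < (outdeg p u)%:R].
have [V [rV Vx]] := linear_conditions T (fun=> 0) id.
apply: (eigenvalue_le (V := V) adjmx_sym) => //.
  apply: leq_trans rV; apply: leq_sub2l.
  rewrite leqNgt; have := ltxx (Delta i); rewrite {2}/Delta top_outdegE.
  rewrite (@kth_largest_count _ (> Delta i)) ?size_map -?enumT ?size_enum_ord //.
    by rewrite count_map count_enum => ->.
  by move=> y z yz xy; exact: lt_le_trans yz.
move=> x xV; have := adjmx_form_star x; rewrite ler_distl => /andP[_].
move/le_trans; apply; rewrite [leRHS]mulrDl lerD2r.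
have -> : \sum_u \sum_(v | star u v) x 0 u * x 0 v =
   \sum_u \sum_(v | star u v && (u \notin T)) x 0 u * x 0 v.
  apply: eq_bigr => u _; have [uT|uT] := boolP (u \in T).
    by rewrite !big1 // => v _; rewrite (Vx x xV u uT) !mul0r.
  by apply: eq_bigl => v; rewrite andbT.
(* Centres lie before [t] and leaves do not, so the two sums of squares together give the squared
   norm once; this is why the factor is [Num.sqrt (Delta i)] and not its double. *)
have := @edge_form_le [rel u v | star u v && (u \notin T)]
  (fun u => (u < t)%N) (fun u => ~~ (u < t)%N) (Delta i) x.
move/(_ _ _ _ _)/(le_trans (ler_norm _)) => /= h.
have -> : (x *m x^T) 0 0 = \sum_u x 0 u ^+ 2.
  by rewrite mxE; apply: eq_bigr => u _; rewrite mxE expr2.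
rewrite [X in _ <= _ * X](bigID (fun u : 'I_n => (u < t)%N)) /=.
apply: h => [u v|u v|u v|u].
- by case/andP => /and3P[].
- by case/andP => /and3P[].
- by case/andP => /and3P[_ _ h] _; rewrite -leqNgt.
have [uT|uT] := boolP (u \in T).
  by rewrite eq_card0 ?ler0n // => v; rewrite inE /= andbF.
move: uT; rewrite inE -leNgt; apply: le_trans; rewrite ler_nat /outdeg.
by apply: subset_leq_card; apply/fintype.subsetP => v; rewrite !inE => /andP[/and3P[]].
Qed.

(** Test space: the span of the top eigenvectors of the stars centred at the more than [i] vertices
    of [T], with [x 0 u] at the centre and [x 0 u / s u] at each of the [D1 u] leaves. Since
    [m < Delta i], all these centres are born before [t], and at most [t <= m] of their children are
    not leaves. *)
Lemma top_eigenvalue_ge i : (i < n)%N -> m < Delta i ->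
  Num.sqrt (Delta i - m) - 2 * Num.sqrt m <= top_eigenvalue R p n i.
Proof.
move=> inn mD.
pose T := [set u : 'I_n | Delta i <= (outdeg p u)%:R].
have Tt u : u \in T -> (u < t)%N.
  rewrite inE ltnNge => h; apply/negP => /outdeg_tail; apply/negP; rewrite -ltNge.
  exact: lt_le_trans h.
pose D1 u : R := #|[pred v | star u v]|%:R.
have D1m u : u \in T -> Delta i - m <= D1 u.
  move=> uT; have ut := Tt u uT.
  rewrite lerBlDr; move: (uT); rewrite inE => /le_trans; apply.
  apply: le_trans (lerD (lexx _) tm); rewrite -natrD ler_nat.
  apply: leq_trans (leq_add (leqnn _) (card_ord_lt n t)).
  rewrite /outdeg -(cardID [pred v : 'I_n | (v < t)%N]) addnC; apply: leq_add.
    apply: subset_leq_card; apply/fintype.subsetP => v; rewrite !inE -leqNgt => /andP[tv uv].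
    by move: uv; rewrite /star /= ut tv => ->.
  by apply: subset_leq_card; apply/fintype.subsetP => v; rewrite !inE => /andP[].
have D1p u : u \in T -> 0 < D1 u by move/D1m; apply: lt_le_trans; rewrite subr_gt0.
pose s u := Num.sqrt (D1 u).
have sp u : u \in T -> 0 < s u by move=> uT; rewrite sqrtr_gt0 D1p.
have ss u : s u * s u = D1 u by rewrite -expr2 sqr_sqrtr // ler0n.
have n0 : (0 < n)%N by apply: leq_ltn_trans inn.
(* The parent as an ordinal. The default value of [insubd] is harmless: [r v] is nonzero only on the
   edges of a star, where [q v] is the true parent. *)
pose q (v : 'I_n) : 'I_n := insubd v (p v).
pose r v : R := if star (q v) v && (q v \in T) then (s (q v))^-1 else 0.
have qE u v : star u v -> q v = u.
  case/and3P => /andP[v0 /eqP pv] _ _; apply: val_inj; rewrite val_insubd pv.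
  by rewrite ltn_ord.
have [V [rV Vx]] := linear_conditions (~: T) r q.
have xs x : (x <= V)%MS -> forall u v, star u v -> u \in T -> x 0 v = x 0 u / s u.
  move=> xV u v uv uT; have vT : v \in ~: T.
    by rewrite inE; apply/negP => /Tt; case/and3P: uv => _ _; rewrite leqNgt => /negP.
  by rewrite (Vx x xV v vT) /r (qE u v uv) uv uT mulrC.
have x0 x : (x <= V)%MS -> forall v, v \notin T ->
   ~~ (star (q v) v && (q v \in T)) -> x 0 v = 0.
  move=> xV v vT h; have vT' : v \in ~: T by rewrite inE.
  by rewrite (Vx x xV v vT') /r (negbTE h) mul0r.
apply: (eigenvalue_ge (V := V) adjmx_sym) => //.
  apply: leq_trans rV; rewrite cardsCs finset.setCK card_ord subKn; last first.
    by rewrite -[leqRHS]card_ord max_card.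
  have := lexx (Delta i); rewrite {2}/Delta top_outdegE.
  rewrite (@kth_largest_count _ (>= Delta i)) ?size_map -?enumT ?size_enum_ord //.
    by rewrite count_map count_enum.
  by move=> y z yz xy; exact: le_trans yz.
move=> x xV; have := adjmx_form_star x; rewrite ler_distl => /andP[+ _].
apply: le_trans; rewrite mulrBl lerD2r.
have -> : \sum_u \sum_(v | star u v) x 0 u * x 0 v = \sum_(u in T) s u * x 0 u ^+ 2.
  rewrite [RHS]big_mkcond; apply: eq_bigr => u _; case: ifPn => uT.
    under eq_bigr => v uv do rewrite (xs x xV u v uv uT).
    rewrite sumr_const -mulr_natl -/(D1 u) -ss; field; exact: lt0r_neq0 (sp u uT).
  rewrite big1 // => v /and3P[_ ut _]; rewrite (x0 x xV u uT) ?mul0r //.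
  by rewrite /star /= [(t <= u)%N]leqNgt ut !andbF.
(* The leaves of a star carry the same total square as its centre:
   [D1 u * (x 0 u / s u) ^+ 2 = x 0 u ^+ 2]. *)
have xx : (x *m x^T) 0 0 <= 2 * \sum_(u in T) x 0 u ^+ 2.
  have -> : (x *m x^T) 0 0 = \sum_u x 0 u ^+ 2.
    by rewrite mxE; apply: eq_bigr => u _; rewrite mxE expr2.
  rewrite (bigID (mem T)) /= mulr_natl mulr2n lerD2l.
  have -> : \sum_(u in T) x 0 u ^+ 2 =
     \sum_(u in T) \sum_(v | star u v) x 0 v ^+ 2.
    apply: eq_bigr => u uT; under eq_bigr => v uv do rewrite (xs x xV u v uv uT).
    rewrite sumr_const -mulr_natl -/(D1 u) -ss; field; exact: lt0r_neq0 (sp u uT).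
  rewrite (exchange_big_dep predT) //= [leLHS]big_mkcond /=; apply: ler_sum => v _.
  have S0 : 0 <= \sum_(u | (u \in T) && star u v) x 0 v ^+ 2.
    by apply: sumr_ge0 => u _; exact: sqr_ge0.
  case: ifPn => // vT; have [/andP[h1 h2]|h] := boolP (star (q v) v && (q v \in T)).
    rewrite (bigD1 (q v)) /=; last by rewrite h1 h2.
    by rewrite lerDl sumr_ge0 // => u _; exact: sqr_ge0.
  rewrite [leLHS](_ : _ = 0) //.
  by rewrite (x0 x xV v vT h) expr0n.
apply: le_trans (ler_wpM2l (sqrtr_ge0 _) xx) _.
rewrite mulrCA ler_pM2l // mulr_sumr; apply: ler_sum => u uT.
by rewrite ler_wpM2r ?sqr_ge0 // ler_wsqrtr // D1m.
Qed.

End TreeSpectrum.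

(** * Products asymptotic to powers *)

Local Open Scope classical_set_scope.
Local Open Scope ring_scope.

(** Since [C / (n + 1) ^ 2 <= 2 C (1 / (n + 1) - 1 / (n + 2))], adding [h] makes the sequence
    nonincreasing and subtracting [h] makes it nondecreasing, where [h] tends to [0]. *)
Lemma cvgn_quadratic_increments (R : realType) (u : R^nat) (C : R) :
  (\forall n \near \oo, `|u n.+1 - u n| <= C / n.+1%:R ^+ 2) -> cvgn u.
Proof.
case=> J _ hJ; pose v (n : nat) := u (n + J)%N.
suff vc : cvgn v 
  by apply/cvg_ex; have /cvg_ex[l vl] := vc; exists l; rewrite -(cvg_shiftn J).
have C0 : 0 <= C.
  have := hJ J (leqnn _); move/(le_trans (normr_ge0 _)); by rewrite pmulr_lge0 ?invr_gt0 ?exprn_gt0.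
pose h (n : nat) : R := 2 * C * harmonic n.
have vh n : `|v n.+1 - v n| <= h n - h n.+1.
  apply: (@le_trans _ _ (C / (n + J).+1%:R ^+ 2)); first exact: (hJ (n + J)%N (leq_addl _ _)).
  rewrite /h /harmonic -mulrBr.
  have n1 : (0 : R) < n.+1%:R by [].
  have n2 : (n.+2)%:R = n.+1%:R + 1 :> R by rewrite -natr1.
  have nJ : (n.+1%:R : R) <= (n + J).+1%:R by rewrite ler_nat ltnS leq_addr.
  have n1' : (1 : R) <= n.+1%:R by rewrite (ler_nat _ 1).
  have -> : 2 * C * (n.+1%:R^-1 - n.+2%:R^-1) = 2 * C / (n.+1%:R * (n.+1%:R + 1)).
    by rewrite n2; field; rewrite !gt_eqF // addr_gt0.
  apply: (@le_trans _ _ (C / n.+1%:R ^+ 2)).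
    by rewrite ler_wpM2l // lef_pV2 ?posrE ?exprn_gt0 // lerXn2r ?nnegrE.
  rewrite [2 * C]mulrC -mulrA ler_wpM2l // ler_pdivlMr ?mulr_gt0 ?addr_gt0 //.
  rewrite mulrC ler_pdivrMr ?exprn_gt0 //; nra.
have hc : h @ \oo --> 0 by rewrite -(mulr0 (2 * C)); apply: cvgMr; exact: cvg_harmonic.
have h0 n : 0 <= h n by rewrite /h mulr_ge0 ?mulr_ge0 ?harmonic_ge0.
have vhd : nonincreasing_seq (v \+ h).
  apply/nonincreasing_seqP => n; have := vh n; rewrite ler_norml /= => /andP[_]; lra.
have vhi : nondecreasing_seq (v \- h).
  apply/nondecreasing_seqP => n; have := vh n; rewrite ler_norml /= => /andP[+ _]; lra.
have c1 : cvgn (v \+ h).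
  apply: nonincreasing_is_cvgn => //; exists (v 0%N - h 0%N) => _ [n _ <-].
  by apply: le_trans (vhi 0%N n (leq0n _)) _ => /=; have := h0 n; lra.
have -> : v = (v \+ h) \- h by apply/funext => n /=; rewrite addrK.
by apply: is_cvgB => //; apply/cvg_ex; exists 0.
Qed.

Lemma cvgn_normr_bound (R : realType) (u : R^nat) : cvgn u ->
  exists2 M : R, 0 < M & forall n, `|u n| <= M.
Proof.
move=> /cvg_seq_bounded[M [_ hM]]; exists (Num.max M 0 + 1) => [|n].
  by rewrite ltr_pwDr // le_max lexx orbT.
by apply: hM => //; rewrite ltr_pwDr // le_max lexx.
Qed.

(** A quotient of Gamma functions, [Gamma(n + (b + s) / th) Gamma(b / th) / (Gamma(n + b / th)
    Gamma((b + s) / th))], hence of order [n ^ (s / th)]. It is used with [th] equal to [gamma] as a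
    function of time, and with [th = 1] as a function of the degree. *)
Definition prodr_affine (R : realType) (th b s : R) (n : nat) : R :=
  \prod_(i < n) (1 + s / (th * i%:R + b)).

Section Asymptotics.
Variables (R : realType) (th b s : R).
Hypotheses (th0 : 0 < th) (b0 : 0 < b) (bs0 : 0 < b + s).

Lemma affine_gt0 (i : nat) : 0 < th * i%:R + b.
Proof. by rewrite ltr_wpDl // mulr_ge0 // ltW. Qed.

Lemma prodr_affine_factor_gt0 (i : nat) : 0 < 1 + s / (th * i%:R + b).
Proof.
have h := affine_gt0 i.
rewrite (_ : 1 + _ = (th * i%:R + b + s) / (th * i%:R + b)); last first.
  by rewrite [RHS]mulrDl divff ?gt_eqF.
rewrite divr_gt0 // -addrA.
by rewrite ltr_wpDl // mulr_ge0 // ltW.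
Qed.

Lemma prodr_affine_gt0 n : 0 < prodr_affine th b s n.
Proof. by apply: prodr_gt0 => i _; exact: prodr_affine_factor_gt0. Qed.

Lemma ln1D_bounds (x : R) : -1 < x -> x / (1 + x) <= ln (1 + x) <= x.
Proof.
move=> x1; have x0 : 0 < 1 + x by lra.
apply/andP; split; last exact: le_ln1Dx.
have y1 : -1 < - (x / (1 + x)).
  by rewrite ltrN2 ltr_pdivrMr // mul1r; lra.
have := le_ln1Dx y1; rewrite (_ : 1 - x / (1 + x) = (1 + x)^-1); last first.
  by field; rewrite gt_eqF.
by rewrite lnV ?posrE // lerN2.
Qed.

(** The logarithm [u] of the ratio has increments [ln (1 + s / y) - s / th * ln (1 + 1 / N)]. Each
    logarithm differs from its linear part by [O(1 / N ^ 2)], and so do the two linear parts from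
    each other; the three constants in the bound are those of [b1], [b2] and [b3]. *)
Lemma prodr_affine_cvg : exists2 kappa : R, 0 < kappa &
  prodr_affine th b s n / n.+1%:R `^ (s / th) @[n --> \oo] --> kappa.
Proof.
pose u (n : nat) : R := ln (prodr_affine th b s n) - s / th * ln n.+1%:R.
have uE n : prodr_affine th b s n / n.+1%:R `^ (s / th) = expR (u n).
  rewrite expRD lnK ?posrE ?prodr_affine_gt0 //; congr (_ * _).
  by rewrite expRN /powR pnatr_eq0.
suff /cvg_ex[l ul] : cvgn u.
  exists (expR l); first exact: expR_gt0.
  under eq_fun do rewrite uE.
  by apply: continuous_cvg ul; exact: continuous_expR.
(* [mu * n.+1] lies below both [th * n + b] and [th * n + b + s], including at [n = 0]. *)
pose mu := Num.min th (Num.min b (b + s)).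
have mu0 : 0 < mu by rewrite !lt_min th0 b0 bs0.
have [mth mb mbs] : [/\ mu <= th, mu <= b & mu <= b + s].
  by split; rewrite /mu !ge_min lexx ?orbT.
apply: (@cvgn_quadratic_increments _ _
  (s ^+ 2 / mu ^+ 2 + `|s / th| + `|s * (th - b)| / (mu * th))).
apply: nearW => n.
have n1 : (0 : R) < n.+1%:R by [].
have nE : (n%:R : R) = n.+1%:R - 1 by rewrite -natr1 addrK.
have n0 : (0 : R) <= n%:R by [].
set N : R := n.+1%:R in n1 nE *.
set y := th * n%:R + b.
have y0 : 0 < y by exact: affine_gt0.
have ymu : mu * N <= y by rewrite /y; rewrite nE in n0 *; nra.
have ysmu : mu * N <= y + s by rewrite /y; rewrite nE in n0 *; nra.
have ys0 : 0 < y + s by apply: lt_le_trans ysmu; rewrite mulr_gt0.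
have -> : u n.+1 - u n = (ln (1 + s / y) - s / y) - s / th * (ln (1 + N^-1) - N^-1)
    + (s / y - s / th * N^-1).
  have -> : u n.+1 = u n + ln (1 + s / y) - s / th * ln (1 + N^-1).
    rewrite /u /prodr_affine big_ord_recr /= lnM ?posrE ?prodr_affine_gt0 //; last first.
      exact: prodr_affine_factor_gt0.
    rewrite (_ : n.+2%:R = N * (1 + N^-1)) ?lnM ?posrE ?addr_gt0 ?invr_gt0 //.
      rewrite /y; ring.
    by rewrite mulrDr mulr1 divff ?gt_eqF // natr1.
  ring.
have b1 : `|ln (1 + s / y) - s / y| <= s ^+ 2 / mu ^+ 2 / N ^+ 2.
  have x1 : -1 < s / y by rewrite ltr_pdivlMr // mulN1r; lra.
  have /andP[l1 l2] := ln1D_bounds x1.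
  rewrite ler0_norm ?subr_le0 // opprB.
  apply: (@le_trans _ _ (s ^+ 2 / (y * (y + s)))).
    apply: le_trans (lerB (lexx _) l1) _; rewrite le_eqVlt; apply/orP; left; apply/eqP.
    by field; rewrite !gt_eqF //; rewrite ?[1 + _]addrC; nra.
  rewrite -mulrA ler_wpM2l ?sqr_ge0 // -invfM lef_pV2 ?posrE ?mulr_gt0 ?exprn_gt0 //.
  rewrite -exprMn expr2; apply: ler_pM => //; rewrite mulr_ge0 // ltW //.
have b2 : `|s / th * (ln (1 + N^-1) - N^-1)| <= `|s / th| / N ^+ 2.
  rewrite normrM ler_wpM2l //.
  have N1 : -1 < N^-1 by apply: lt_trans (_ : 0 < _); rewrite ?invr_gt0 ?ltrN10.
  have /andP[l1 l2] := ln1D_bounds N1.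
  rewrite ler0_norm ?subr_le0 // opprB; apply: le_trans (lerB (lexx _) l1) _.
  have -> : N^-1 - N^-1 / (1 + N^-1) = (N * (N + 1))^-1.
    by field; rewrite !gt_eqF // addr_gt0.
  by rewrite lef_pV2 ?posrE ?mulr_gt0 ?addr_gt0 ?exprn_gt0 //; nra.
have b3 : `|s / y - s / th * N^-1| <= `|s * (th - b)| / (mu * th) / N ^+ 2.
  have -> : s / y - s / th * N^-1 = s * (th - b) / (y * (th * N)).
    have -> : th - b = th * N - y by rewrite /y nE; ring.
    by field; rewrite !gt_eqF.
  rewrite normrM [`|_^-1|]gtr0_norm ?invr_gt0 ?mulr_gt0 // -mulrA ler_wpM2l //.
  rewrite -invfM lef_pV2 ?posrE ?mulr_gt0 ?exprn_gt0 //.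
  by rewrite expr2 mulrACA ler_wpM2r // mulr_ge0 // ltW.
rewrite !mulrDl; apply: le_trans (ler_normD _ _) _; apply: lerD => //.
by apply: le_trans (ler_normB _ _) _; apply: lerD.
Qed.

Lemma prodr_affine_bounds : exists C1 C2 : R, [/\ 0 < C1, 0 < C2 &
  forall n, C1 * n.+1%:R `^ (s / th) <= prodr_affine th b s n <= C2 * n.+1%:R `^ (s / th)].
Proof.
have [k k0 rk] := prodr_affine_cvg.
set r := fun n => _ / _ in rk.
have w0 n : 0 < (n.+1%:R : R) `^ (s / th) by rewrite powR_gt0.
have r0 n : 0 < r n by rewrite divr_gt0 ?prodr_affine_gt0.
have [M1 M10 h1] : exists2 M : R, 0 < M & forall n, `|r n| <= M.
  by apply: cvgn_normr_bound; apply/cvg_ex; exists k.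
have [M2 M20 h2] : exists2 M : R, 0 < M & forall n, `|(r n)^-1| <= M.
  by apply: cvgn_normr_bound; apply/cvg_ex; exists k^-1; apply: cvgV => //; rewrite gt_eqF.
exists M2^-1, M1; split; rewrite ?invr_gt0 // => n.
rewrite -[X in X && _]ler_pdivlMr // -[X in _ && X]ler_pdivrMr //; apply/andP; split; last first.
  by have := h1 n; rewrite (gtr0_norm (r0 n)); apply.
have := h2 n; rewrite gtr0_norm ?invr_gt0 // => h.
rewrite -/(r n); by rewrite -[leRHS]invrK lef_pV2 ?posrE ?invr_gt0.
Qed.

End Asymptotics.

(** * Expectations over histories *)

(** The vertex is a number and not an ordinal, so that trees of different sizes are compared on one
    index set; in a recursive tree an unborn vertex has degree [0]. The sum starts at [1] because
    [h 0] is not a parent. *)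
Definition deg (h : nat -> nat) (n v : nat) : nat :=
  (\sum_(1 <= w < n) (h w == v))%N.

Definition update (h : nat -> nat) (n v : nat) : nat -> nat :=
  fun m => if m == n then v else h m.

Definition agree (n : nat) (h h' : nat -> nat) :=
  forall m, (0 < m < n)%N -> h m = h' m.

(** Combinatorial form of being measurable with respect to the [n]-th tree. *)
Definition local (T : Type) (n : nat) (F : (nat -> nat) -> T) :=
  forall h h', agree n h h' -> F h = F h'.

Lemma degE (h : nat -> nat) (n : nat) (v : 'I_n) : outdeg h v = deg h n v.
Proof.
rewrite /outdeg -sum1_card big_mkcond /= /deg.
rewrite -(big_mkord xpredT (fun w => if (0 < w)%N && (h w == v) then 1%N else 0%N)).
case: n v => [[]//|n] v.
by rewrite big_ltn // add0n; apply: eq_big_nat => w /andP[-> _]; case: (h w == v).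
Qed.

Lemma degS h n v : (0 < n)%N -> deg h n.+1 v = (deg h n v + (h n == v))%N.
Proof. by move=> n0; rewrite /deg big_nat_recr. Qed.

Lemma deg_local n v : local n (fun h => deg h n v).
Proof. by move=> h h' hh; apply: eq_big_nat => w wn; rewrite hh. Qed.

Lemma deg_update h n u v : deg (update h n u) n v = deg h n v.
Proof.
by apply: deg_local => m /andP[_ mn]; rewrite /update ltn_eqF.
Qed.

Lemma deg_born h v : recursive_tree h -> deg h v.+1 v = 0%N.
Proof.
move=> hr; rewrite /deg big_nat_cond big1 // => w /andP[/andP[w0 wv] _].
by rewrite ltn_eqF // (leq_trans (hr _ w0)).
Qed.

Lemma deg_le h n n' v : (n <= n')%N -> (deg h n v <= deg h n' v)%N.
Proof.
case: n => [|n nn]; first by rewrite /deg big_geq.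
by rewrite /deg [X in (_ <= X)%N](big_cat_nat _ nn) // leq_addr.
Qed.

Lemma deg_unborn h n v : recursive_tree h -> (n <= v)%N -> deg h n v = 0%N.
Proof.
move=> hr nv; apply/eqP; rewrite -leqn0 -(deg_born v hr).
by apply: deg_le; exact: leqW.
Qed.

Lemma local_le (T : Type) n n' (F : (nat -> nat) -> T) :
  (n <= n')%N -> local n F -> local n' F.
Proof.
move=> nn Fn h h' hh; apply: Fn => m /andP[m0 mn]; apply: hh.
by rewrite m0 (leq_trans mn).
Qed.

Lemma sum_deg h n : recursive_tree h -> (0 < n)%N -> (\sum_(u < n) deg h n u = n.-1)%N.
Proof.
move=> hr n0; rewrite /deg exchange_big /=.
rewrite -[RHS]card_ord -sum1_card -(big_mkord xpredT (fun=> 1%N)).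
rewrite -[n in LHS](prednK n0) big_add1 /=; apply: eq_big_nat => w /andP[_ wn].
have hw : (h w.+1 < n.-1.+1)%N by apply: leq_trans (hr _ _) _ => //; exact: ltnW.
rewrite (bigD1 (Ordinal hw)) //= eqxx big1 // => u /eqP uw.
by apply/eqP; rewrite eqb0; apply/eqP => e; apply: uw; apply: val_inj.
Qed.

(* One representative per history up to time [n]; the irrelevant values, at [0]
   and from [n] on, are set to [0]. *)
Fixpoint histories (n : nat) : seq (nat -> nat) :=
  match n with
  | 0 => [:: fun=> 0%N]
  | 0.+1 => [:: fun=> 0%N]
  | n'.+1 => [seq update h n' v | h <- histories n', v <- iota 0 n']
  end.

Lemma historiesS n : (0 < n)%N ->
  histories n.+1 = [seq update h n v | h <- histories n, v <- iota 0 n].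
Proof. by case: n. Qed.

Lemma big_historiesS (R : nmodType) n (F : (nat -> nat) -> R) : (0 < n)%N ->
  \sum_(h <- histories n.+1) F h = \sum_(h <- histories n) \sum_(v < n) F (update h n v).
Proof.
move=> n0; rewrite historiesS // big_allpairs_dep /=; apply: eq_bigr => h _.
by rewrite -(big_mkord xpredT (fun v => F (update h n v))) /index_iota subn0.
Qed.

Lemma update_recursive h n v : recursive_tree h -> (v < n)%N ->
  recursive_tree (update h n v).
Proof. by move=> hr vn m m0; rewrite /update; case: eqP => [->|_] //; exact: hr. Qed.

Lemma ler_sum_histories (R : numDomainType) n (F G : (nat -> nat) -> R) :
  (forall h, recursive_tree h -> F h <= G h) ->
  \sum_(h <- histories n) F h <= \sum_(h <- histories n) G h.
Proof.
elim: n F G => [|[|n] IH] F G FG; try by rewrite !big_seq1 FG.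
rewrite [leLHS]big_historiesS // [leRHS]big_historiesS //; apply: IH => h hr; apply: ler_sum => v _.
by apply: FG; exact: update_recursive.
Qed.

Section Expectation.
Context d (Omega : measurableType d) (R : realType) (P : probability Omega R).
Variables (a : R) (par : nat -> {RV P >-> nat}).
Hypotheses (ha : -1 < a) (hpar : linear_pref_attachment a par).

Definition tree (w : Omega) : nat -> nat := fun m => par m w.

Lemma tree_recursive w : recursive_tree (tree w).
Proof. by move=> m m0; exact: hpar.1. Qed.

Lemma historyS n h : (0 < n)%N ->
  history par n.+1 h = history par n h `&` par n @^-1` [set h n].
Proof.
move=> n0; apply/seteqP; split=> w /=.
  by move=> H; split=> [m /andP[m0 mn]|]; apply: H; rewrite ?m0 ?n0 //= ltnW.
by move=> [H Hn] m /andP[m0]; rewrite ltnS leq_eqVlt => /predU1P[->//|mn]; apply: H; rewrite m0.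
Qed.

Lemma history_small n h : (n <= 1)%N -> history par n h = setT.
Proof.
move=> n1; apply/seteqP; split=> // w _ m /andP[m0 mn].
by have := leq_trans mn n1; rewrite ltnS leqn0 => /eqP m00; rewrite m00 in m0.
Qed.

Lemma history_update n h v : history par n (update h n v) = history par n h.
Proof.
apply/seteqP; split=> w H m mn; rewrite (H m mn) /update.
  by case/andP: mn => _ mn; rewrite ltn_eqF.
by case/andP: mn => _ mn; rewrite ltn_eqF.
Qed.

Lemma measurable_history n h : measurable (history par n h).
Proof.
elim: n => [|[|n] IH]; try by rewrite history_small //; exact: measurableT.
rewrite historyS //.
by apply: measurableI => //; rewrite -[_ @^-1` _]setTI; exact: measurable_funP.
Qed.

(** The events [history par n h], for [h] in [histories n], partition the probability space. This
    makes every local function simple, hence measurable and integrable. *)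
Lemma tree_sum n (F : (nat -> nat) -> R) w : local n F ->
  F (tree w) = \sum_(h <- histories n) F h * \1_(history par n h) w.
Proof.
elim: n F => [|[|n] IH] F Fl.
- rewrite /= big_seq1 history_small // indicT mulr1; apply: Fl => m.
  by rewrite ltn0 andbF.
- rewrite /= big_seq1 history_small // indicT mulr1; apply: Fl => m.
  by rewrite ltnS leqn0 => /andP[/lt0n_neq0/negbTE ->].
rewrite big_historiesS //.
pose k := par n.+1 w.
have kn : (k < n.+1)%N by exact: hpar.1.
(* Freezing the last parent at its actual value [k] leaves a function of the shorter history; in the
   inner sum only the term [v = k] survives. *)
pose G h := F (update h n.+1 k).
have Gl : local n.+1 G.
  move=> h h' hh; apply: Fl => m /andP[m0 mn]; rewrite /update.
  by case: eqP => // /eqP mN; apply: hh; rewrite m0 ltn_neqAle mN.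
transitivity (G (tree w)).
  by apply: Fl => m _; rewrite /update; case: eqP => [->|].
rewrite (IH G Gl); apply: eq_bigr => h _.
rewrite (bigD1 (Ordinal kn)) //= big1 ?addr0 => [|v /eqP vk].
  rewrite /G /=; congr (_ * _); rewrite (@historyS n.+1 (update h _ _)) // history_update !indicE.
  congr (_%:R); congr (nat_of_bool _); apply: asbool_equiv_eq; split; last by case.
  by move=> H; split=> //=; rewrite /update eqxx.
rewrite (@historyS n.+1 (update h _ _)) // indicE memNset ?mulr0 // => -[_ /=].
by rewrite /update eqxx => e; apply: vk; apply: val_inj => /=; rewrite -e.
Qed.

Lemma measurable_tree n (F : (nat -> nat) -> R) : local n F ->
  measurable_fun setT (F \o tree).
Proof.
move=> Fl; have -> : F \o tree =
    fun w => \sum_(h <- histories n) (F h * \1_(history par n h) w).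
  by apply/funext => w; exact: tree_sum.
apply: measurable_sum => h; apply: measurable_funM; first exact: measurable_cst.
by apply: measurable_indic; exact: measurable_history.
Qed.

(** For [F] local to [n] this is the expectation of [F] along the random tree, by [integral_tree].
    As a finite sum it makes linearity and conditioning plain algebra. *)
Definition tree_mean (n : nat) (F : (nat -> nat) -> R) : R :=
  \sum_(h <- histories n) F h * fine (P (history par n h)).

Lemma integral_tree n (F : (nat -> nat) -> R) : local n F ->
  (\int[P]_w (F (tree w))%:E = (tree_mean n F)%:E)%E.
Proof.
move=> Fl; under eq_integral do rewrite (tree_sum _ Fl) -sumEFin.
have mi h : P.-integrable setT (fun w => (F h * \1_(history par n h) w)%:E).
  rewrite (_ : (fun w => _) = (fun w => (F h)%:E * (\1_(history par n h) w)%:E)%E) //.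
  by apply: integrableZl => //; apply: integrable_indic; exact: measurable_history.
rewrite integral_sum //= /tree_mean -sumEFin; apply: eq_bigr => h _.
under eq_integral do rewrite EFinM.
rewrite integralZl //; last by apply: integrable_indic; exact: measurable_history.
rewrite integral_indic //; last exact: measurable_history.
rewrite setIT EFinM fineK //; apply: fin_num_measure; exact: measurable_history.
Qed.

(** For [F] local to [n.+1], the conditional expectation of [F] given that the [n]-th tree is that
    of [h]; [tree_meanS] is the tower property. *)
Definition step (n : nat) (F : (nat -> nat) -> R) (h : nat -> nat) : R :=
  \sum_(v < n) attach_prob a h v * F (update h n v).

Lemma tree_meanS n F : (0 < n)%N -> tree_mean n.+1 F = tree_mean n (step n F).
Proof.
move=> n0; rewrite /tree_mean big_historiesS //; apply: eq_bigr => h _.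
rewrite mulr_suml; apply: eq_bigr => v _.
rewrite historyS // history_update /update eqxx hpar.2 -/(update h n v).
have Pf : P (history par n h) \is a fin_num by apply: fin_num_measure; exact: measurable_history.
by rewrite fineM //=; ring.
Qed.

End Expectation.

(** * Moments and the degree martingale *)

Section Moments.
Context d (Omega : measurableType d) (R : realType) (P : probability Omega R).
Variables (a : R) (par : nat -> {RV P >-> nat}).
Hypotheses (ha : -1 < a) (hpar : linear_pref_attachment a par).
Local Notation E := (tree_mean par).

Lemma tree_mean_le n F G : (forall h, recursive_tree h -> F h <= G h) -> E n F <= E n G.
Proof.
move=> FG; apply: ler_sum_histories => h hr; apply: ler_wpM2r; last exact: FG.
by apply: fine_ge0.
Qed.

Lemma tree_mean_eq n F G : (forall h, recursive_tree h -> F h = G h) -> E n F = E n G.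
Proof. by move=> FG; apply/le_anti; rewrite !tree_mean_le // => h /FG ->. Qed.

Lemma tree_meanD n F G : E n (F \+ G) = E n F + E n G.
Proof. by rewrite /tree_mean -big_split; apply: eq_bigr => h _; rewrite mulrDl. Qed.

Lemma tree_meanZ n k F : E n (fun h => k * F h) = k * E n F.
Proof. by rewrite /tree_mean mulr_sumr; apply: eq_bigr => h _; rewrite mulrA. Qed.

Lemma tree_mean_sum n (I : Type) (r : seq I) (F : I -> (nat -> nat) -> R) :
  E n (fun h => \sum_(i <- r) F i h) = \sum_(i <- r) E n (F i).
Proof.
rewrite /tree_mean [RHS]exchange_big; apply: eq_bigr => h _; exact: mulr_suml.
Qed.

Lemma tree_mean1 n : E n (fun=> 1) = 1.
Proof.
apply: EFin_inj; rewrite -(integral_tree (a := a)) //.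
by rewrite integral_cst //= mul1e; exact: probability_setT.
Qed.

Local Notation c := (1 + a).
Local Notation gam := (a + 2).

Lemma leaf_weight_gt0 : 0 < c. Proof. by rewrite -ltrBlDl sub0r. Qed.
Lemma gamma_gt0 : 0 < gam. Proof. have := leaf_weight_gt0; lra. Qed.

(** The total weight is deterministic, as [n] vertices have [n.-1] children in all. The form
    [gam * n.-1 + c], which equals [gam * n - 1], matches the factors of [prodr_affine]. *)
Lemma weight_sum h n : recursive_tree h -> (0 < n)%N ->
  \sum_(u < n) ((outdeg h u)%:R + 1 + a) = gam * n.-1%:R + c.
Proof.
move=> hr n0; rewrite !big_split /= !sumr_const !card_ord.
under eq_bigr do rewrite degE; rewrite -natr_sum sum_deg //.
rewrite -{2 3}(prednK n0) -[a *+ _]mulr_natl -(natr1 n.-1); ring.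
Qed.

Lemma weight_gt0 n : 0 < gam * n%:R + c.
Proof. by apply: affine_gt0; [exact: gamma_gt0|exact: leaf_weight_gt0]. Qed.

Lemma step_deg n v (phi : (nat -> nat) -> R) (g : nat -> R) h :
  (v < n)%N -> local n phi -> recursive_tree h ->
  step a n (fun h => phi h * g (deg h n.+1 v)) h =
  phi h * (g (deg h n v) + (g (deg h n v).+1 - g (deg h n v)) *
    ((deg h n v)%:R + c) / (gam * n.-1%:R + c)).
Proof.
move=> vn phil hr; have n0 : (0 < n)%N by apply: leq_ltn_trans vn.
have W0 : gam * n.-1%:R + c != 0 by rewrite gt_eqF // weight_gt0.
set W := _ + c in W0 *; set D := deg h n v.
have apE (u : 'I_n) : attach_prob a h u = ((deg h n u)%:R + c) / W.
  by rewrite /attach_prob weight_sum // degE -addrA.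
have ap1 : \sum_(u < n) attach_prob a h u = 1.
  by rewrite -mulr_suml weight_sum // divff.
have phiE u : phi (update h n u) = phi h.
  by apply: phil => m /andP[_ mn]; rewrite /update ltn_eqF.
rewrite /step.
transitivity (phi h * \sum_(u < n) (attach_prob a h u * g D +
  (if u == Ordinal vn then attach_prob a h u * (g D.+1 - g D) else 0))).
  rewrite mulr_sumr; apply: eq_bigr => u _; rewrite phiE degS // deg_update.
  rewrite /update eqxx -/D mulrCA; congr (_ * _).
  have -> : (u == v :> nat) = (u == Ordinal vn) by [].
  by case: eqP => _; rewrite ?addn1 ?addn0; ring.
rewrite big_split /= -mulr_suml ap1 mul1r -big_mkcond big_pred1_eq apE /=.
by congr (_ * (_ + _)); rewrite -/D; ring.
Qed.

(* [pa_fun s (deg h n v) / pa_norm s n] is a martingale in [n], for [v < n]. *)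
Definition pa_norm (s : R) (n : nat) : R := prodr_affine gam c s n.-1.
Definition pa_fun (s : R) (j : nat) : R := prodr_affine 1 c s j.

Lemma pa_norm_gt0 s n : 0 < c + s -> 0 < pa_norm s n.
Proof. by move=> cs; apply: prodr_affine_gt0 => //; [exact: gamma_gt0|exact: leaf_weight_gt0]. Qed.

Lemma pa_fun_gt0 s j : 0 < c + s -> 0 < pa_fun s j.
Proof. by move=> cs; apply: prodr_affine_gt0 => //; exact: leaf_weight_gt0. Qed.

Lemma pa_normS s n : (0 < n)%N ->
  pa_norm s n.+1 = pa_norm s n * (1 + s / (gam * n.-1%:R + c)).
Proof. by case: n => // n _; rewrite /pa_norm /prodr_affine big_ord_recr. Qed.

Lemma pa_funS s j : pa_fun s j.+1 = pa_fun s j * (1 + s / (j%:R + c)).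
Proof. by rewrite /pa_fun /prodr_affine big_ord_recr /= mul1r. Qed.

Lemma pa_fun_local s n v : local n (fun h => pa_fun s (deg h n v)).
Proof. by move=> h h' /(@deg_local n v) /= ->. Qed.

(** One attachment to [v] changes [pa_fun s] at degree [D] by the relative amount [s / (D + c)] and
    has probability [(D + c) / W]; the weight [D + c] cancels and leaves the factor [1 + s / W],
    free of [D]. The function [phi] of the past is carried along so that mixed moments at two times
    are covered as well. *)
Lemma mean_pa_fun s m n v (phi : (nat -> nat) -> R) : 0 < c + s ->
  (v < m)%N -> (m <= n)%N -> local m phi ->
  E n (fun h => phi h * pa_fun s (deg h n v)) =
  E m (fun h => phi h * pa_fun s (deg h m v)) * (pa_norm s n / pa_norm s m).
Proof.
move=> cs vm mn phil; elim: n mn => [|n IH].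
  by rewrite leqn0 => /eqP m0; rewrite m0 in vm.
rewrite leq_eqVlt => /predU1P[<-|]; first by rewrite divff ?mulr1 // gt_eqF // pa_norm_gt0.
rewrite ltnS => mn; have vn := leq_trans vm mn.
have n0 : (0 < n)%N by apply: leq_ltn_trans vn.
rewrite (tree_meanS hpar _ n0) pa_normS //.
rewrite [pa_norm s n * _]mulrC -[_ * _ / pa_norm s m]mulrA mulrCA -IH // -tree_meanZ.
 apply: tree_mean_eq => h hr.
rewrite (step_deg _ vn) //; last exact: local_le phil.
rewrite pa_funS.
have W0 : gam * n.-1%:R + c != 0 by rewrite gt_eqF // weight_gt0.
have D0 : (deg h n v)%:R + c != 0 by rewrite gt_eqF // ltr_wpDl // leaf_weight_gt0.
by field; rewrite W0 D0.
Qed.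

Lemma mean_pa_fun_born s n v : 0 < c + s -> (v < n)%N ->
  E n (fun h => pa_fun s (deg h n v)) = pa_norm s n / pa_norm s v.+1.
Proof.
move=> cs vn; have := @mean_pa_fun s v.+1 n v (fun=> 1) cs (leqnn _) vn.
move/(_ (fun _ _ _ => erefl)).
under eq_fun do rewrite mul1r; move=> ->.
rewrite (_ : E _ _ = 1) ?mul1r // -[RHS](tree_mean1 v.+1).
by apply: tree_mean_eq => h hr; rewrite deg_born // /pa_fun /prodr_affine big_ord0 mulr1.
Qed.

(** The case [s = 0] of [mean_pa_fun], where both products are identically [1]. *)
Lemma tree_mean_local m n F : (0 < m)%N -> (m <= n)%N -> local m F -> E n F = E m F.
Proof.
move=> m0 mn Fl; have := @mean_pa_fun 0 m n 0%N F; rewrite addr0.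
move/(_ leaf_weight_gt0 m0 mn Fl); have E0 k : pa_norm 0 k = 1.
  by rewrite /pa_norm /prodr_affine big1 // => i _; rewrite mul0r addr0.
have E1 k : pa_fun 0 k = 1.
  by rewrite /pa_fun /prodr_affine big1 // => i _; rewrite mul0r addr0.
rewrite !E0 divff // mulr1 /tree_mean; under eq_bigr do rewrite E1 mulr1.
by move=> ->; apply: eq_bigr => h _; rewrite E1 mulr1.
Qed.

Definition pa_mart (n v : nat) (h : nat -> nat) : R :=
  pa_fun 1 (deg h n v) / pa_norm 1 n.

Lemma pa_fun1E j : pa_fun 1 j = (j%:R + c) / c.
Proof.
have c0 := leaf_weight_gt0; elim: j => [|j IH].
  by rewrite /pa_fun /prodr_affine big_ord0 add0r divff // gt_eqF.
rewrite pa_funS IH -natr1; have D0 : 0 < j%:R + c by rewrite ltr_wpDl.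
by field; rewrite !gt_eqF.
Qed.

Lemma pa_fun2E j : pa_fun 2 j = (j%:R + c) * (j%:R + c + 1) / (c * (c + 1)).
Proof.
have c0 := leaf_weight_gt0; have c1 : 0 < c + 1 by lra.
elim: j => [|j IH].
  by rewrite /pa_fun /prodr_affine big_ord0 add0r divff // gt_eqF // mulr_gt0.
rewrite pa_funS IH -natr1; have D0 : 0 < j%:R + c by rewrite ltr_wpDl.
by field; rewrite !gt_eqF // ?addrA.
Qed.

Lemma pa_norm1_ge1 n : 1 <= pa_norm 1 n.
Proof.
rewrite /pa_norm /prodr_affine; elim/big_rec: _ => // i x _ x1.
by apply: mulr_ege1 => //; rewrite lerDl divr_ge0 // ltW // weight_gt0.
Qed.

Lemma pa_norm1_le m n : (m <= n)%N -> pa_norm 1 m <= pa_norm 1 n.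
Proof.
have c1 : 0 < c + 1 by have := leaf_weight_gt0; lra.
move=> /subnK <-; elim: (n - m)%N => // k IH; apply: le_trans IH _.
rewrite addSn; case: (k + m)%N => // l; rewrite (pa_normS _ (ltn0Sn l)) ler_peMr //.
  by apply/ltW/pa_norm_gt0.
by rewrite lerDl divr_ge0 // ltW // weight_gt0.
Qed.

(** Each step multiplies the ratio by [(1 + 2 x) / (1 + x) ^ 2 <= 1], with [x] the inverse of the
    total weight. *)
Lemma pa_norm21_le m n : (m <= n)%N ->
  pa_norm 2 n / pa_norm 1 n ^+ 2 <= pa_norm 2 m / pa_norm 1 m ^+ 2.
Proof.
have c1 : 0 < c + 1 by have := leaf_weight_gt0; lra.
have c2 : 0 < c + 2 by have := leaf_weight_gt0; lra.
move=> /subnK <-; elim: (n - m)%N => // k; apply: le_trans.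
rewrite addSn; case: (k + m)%N => // l; rewrite !(pa_normS _ (ltn0Sn l)).
have W0 := weight_gt0 l; set W := _ + c in W0 *.
have p1 := pa_norm_gt0 l.+1 c1; have p2 := pa_norm_gt0 l.+1 c2.
have x0 : 0 < W^-1 by rewrite invr_gt0.
rewrite exprMn invfM mulrACA -[leRHS]mulr1 ler_pM2l ?divr_gt0 ?exprn_gt0 //.
by rewrite ler_pdivrMr ?exprn_gt0 ?addr_gt0 //; nra.
Qed.

(* The martingale property makes the increment orthogonal to the past, so the
   variance of the increment is the difference of the explicit second moments. *)
Lemma pa_mart_increment m n v : (v < m)%N -> (m <= n)%N ->
  E n (fun h => (pa_mart n v h - pa_mart m v h) ^+ 2) <= (c * pa_norm 1 m)^-1.
Proof.
have c0 := leaf_weight_gt0; have c1 : 0 < c + 1 by lra.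
have c2 : 0 < c + 2 by lra.
move=> vm mn; have vn := leq_trans vm mn.
have m0 : (0 < m)%N by apply: leq_ltn_trans vm.
pose x k h := pa_fun 1 (deg h k v).
have pn := pa_norm_gt0 n c1; have pm := pa_norm_gt0 m c1.
have xl : local m (x m) by exact: pa_fun_local.
(* The square of [pa_fun 1] is a combination of [pa_fun 2] and [pa_fun 1], both of known mean. *)
have S k : (v < k)%N -> E k (fun h => x k h * x k h) =
    (c + 1) / c * (pa_norm 2 k / pa_norm 2 v.+1) - c^-1 * (pa_norm 1 k / pa_norm 1 v.+1).
  move=> vk; rewrite -!mean_pa_fun_born // -mulNr -!tree_meanZ -tree_meanD.
  apply: tree_mean_eq => h hr /=; rewrite /x pa_fun1E pa_fun2E.
  by field; rewrite !gt_eqF // ?addrA.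
have C : E n (fun h => x m h * x n h) =
    E m (fun h => x m h * x m h) * (pa_norm 1 n / pa_norm 1 m).
  by apply: mean_pa_fun.
have Mm : E n (fun h => x m h * x m h) = E m (fun h => x m h * x m h).
  by apply: tree_mean_local => // h h' hh; rewrite (xl _ _ hh).
have -> : E n (fun h => (pa_mart n v h - pa_mart m v h) ^+ 2) =
    E n (fun h => x n h * x n h) / pa_norm 1 n ^+ 2 -
    E m (fun h => x m h * x m h) / pa_norm 1 m ^+ 2.
  transitivity ((pa_norm 1 n ^+ 2)^-1 * E n (fun h => x n h * x n h) +
     ((- 2 / (pa_norm 1 n * pa_norm 1 m)) * E n (fun h => x m h * x n h) +
      (pa_norm 1 m ^+ 2)^-1 * E n (fun h => x m h * x m h))).
    rewrite -!tree_meanZ -!tree_meanD; apply: tree_mean_eq => h hr.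
    by rewrite /pa_mart -/(x n h) -/(x m h) /=; field; rewrite !gt_eqF.
  by rewrite C Mm; field; rewrite !gt_eqF.
rewrite !S //.
have h1 := pa_norm21_le mn.
have p2v := pa_norm_gt0 v.+1 c2.
have p1v := pa_norm1_ge1 v.+1.
set A2 := pa_norm 2 n in h1 *; set B2 := pa_norm 2 m in h1 *; set V2 := pa_norm 2 v.+1 in p2v *.
set A := pa_norm 1 n in pn h1 *; set B := pa_norm 1 m in pm h1 *; set V := pa_norm 1 v.+1 in p1v *.
have V0 : 0 < V by apply: lt_le_trans p1v.
have -> : ((c + 1) / c * (A2 / V2) - c^-1 * (A / V)) / A ^+ 2 -
    ((c + 1) / c * (B2 / V2) - c^-1 * (B / V)) / B ^+ 2 =
    (c + 1) / c / V2 * (A2 / A ^+ 2 - B2 / B ^+ 2) + (c * V)^-1 * (B^-1 - A^-1).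
  by field; rewrite !gt_eqF.
(* The first summand is nonpositive by [pa_norm21_le]. In the second, [V >= 1] removes the
   dependence on the birth time [v], so that the bound is uniform over the vertices. *)
apply: (@le_trans _ _ (0 + (c * V)^-1 * B^-1)).
  apply: lerD; first by rewrite mulr_ge0_le0 ?subr_le0 // !divr_ge0 // ltW.
  apply: ler_wpM2l; first by rewrite invr_ge0 ltW // mulr_gt0.
  by rewrite gerDl oppr_le0 invr_ge0 ltW.
rewrite add0r -invfM lef_pV2 ?posrE ?mulr_gt0 //.
by rewrite -[in leRHS]mulrA [V * _]mulrC mulrA; apply: ler_peMr => //; rewrite ltW // mulr_gt0.
Qed.

End Moments.

(** * Almost sure bounds *)

Lemma sum_inv_sqr_le (R : realFieldType) (n : nat) :
  \sum_(0 <= i < n) (i.+1%:R ^+ 2)^-1 <= 2 :> R.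
Proof.
suff : \sum_(0 <= i < n) (i.+1%:R ^+ 2)^-1 <= 2 - n%:R^-1 :> R.
  by move=> /le_trans; apply; rewrite gerBl invr_ge0.
elim: n => [|[|n] IH]; first by rewrite big_geq // invr0; lra.
  by rewrite big_nat1 expr1n invr1; lra.
rewrite big_nat_recr //=; apply: le_trans (lerD IH (lexx _)) _.
have n0 : 0 <= n%:R :> R by [].
rewrite -[n.+2%:R]natr1 -[n.+1%:R]natr1.
set x : R := n%:R in n0 *.
have h : ((x + 1 + 1) ^+ 2)^-1 <= (x + 1)^-1 - (x + 1 + 1)^-1.
  have -> : (x + 1)^-1 - (x + 1 + 1)^-1 = ((x + 1) * (x + 1 + 1))^-1.
    by field; rewrite !gt_eqF //; lra.
  by rewrite lef_pV2 ?posrE; nra.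
lra.
Qed.

Section AlmostSure.
Context d (Omega : measurableType d) (R : realType) (P : probability Omega R).
Variables (a : R) (par : nat -> {RV P >-> nat}).
Hypotheses (ha : -1 < a) (hpar : linear_pref_attachment a par).
Local Notation E := (tree_mean par).
Local Notation c := (1 + a).
Local Notation gam := (a + 2).

(** Markov and Borel-Cantelli. It is applied to sums of nonnegative terms over all vertices
    concerned: when the sum is at most [1], so is each term, which replaces a union bound. *)
Lemma ae_eventually_le1 (N : nat -> nat) (U : nat -> (nat -> nat) -> R) (C : R) :
  (forall n, local (N n) (U n)) -> (forall n h, recursive_tree h -> 0 <= U n h) ->
  (forall n, E (N n) (U n) <= C / n.+1%:R ^+ 2) ->
  \forall w \ae P, \forall n \near \oo, U n (tree par w) <= 1.
Proof.
move=> Ul U0 UC.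
pose F n := [set w | 1 < U n (tree par w)].
have mU n : measurable_fun setT (U n \o tree par).
  exact: measurable_tree hpar _ _ (Ul n).
have mF n : measurable (F n).
  rewrite -[F n]setTI; have := mU n measurableT `]1, +oo[%classic.
  rewrite (_ : F n = (U n \o tree par) @^-1` `]1, +oo[); first by apply; exact: measurable_itv.
  by apply/seteqP; split=> w /=; rewrite in_itv /= andbT.
have PF n : (P (F n) <= (C / n.+1%:R ^+ 2)%:E)%E.
  pose G h : R := ((1 < U n h)%R : bool)%:R.
  have Gl : local (N n) G by move=> h h' /(Ul n) hh; rewrite /G hh.
  have -> : P (F n) = (\int[P]_w (G (tree par w))%:E)%E.
    rewrite -[F n in LHS]setIT -integral_indic //; apply: eq_integral => w _.
    by rewrite indicE /G; congr (_%:R%:E); congr nat_of_bool; apply/idP/idP; rewrite inE.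
  rewrite (integral_tree hpar Gl) lee_fin; apply: le_trans (UC n).
  apply: tree_mean_le => h hr; rewrite /G; case: ltP => [/ltW //|_]; exact: U0.
have sF : (\sum_(n <oo) P (F n) < +oo)%E.
  apply: (@le_lt_trans _ _ (C * 2)%:E); last by rewrite ltry.
  apply: lime_le; first by apply: is_cvg_nneseries.
  apply: nearW => n; apply: (@le_trans _ _ (\sum_(0 <= i < n) (C / i.+1%:R ^+ 2)%:E)%E).
    by apply: lee_sum => i _; exact: PF.
  have C0 : 0 <= C.
    have := UC 0%N; rewrite expr1n divr1; apply: le_trans.
    rewrite -[leLHS](mul0r (E (N 0%N) (fun=> 0))) -tree_meanZ.
    by apply: tree_mean_le => h hr; rewrite mul0r; exact: U0.
  by rewrite sumEFin lee_fin -mulr_sumr ler_wpM2l // sum_inv_sqr_le.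
have P0 := lim_sup_set_cvg0 mF sF.
exists (lim_sup_set F); split => //.
  by apply: bigcap_measurable => // k _; apply: bigcup_measurable => j _; exact: mF.
move=> w /= H n _; apply: contrapT => h; apply: H.
exists n => // m /= nm; rewrite leNgt; apply/negP => lt1; apply: h.
by exists m.
Qed.

Lemma pa_norm_bounds s : 0 < c + s -> exists C1 C2 : R, [/\ 0 < C1, 0 < C2 &
  forall n, (0 < n)%N -> C1 * n%:R `^ (s / gam) <= pa_norm a s n <= C2 * n%:R `^ (s / gam)].
Proof.
move=> cs; have [C1 [C2 [C10 C20 H]]] := prodr_affine_bounds (gamma_gt0 ha) (leaf_weight_gt0 ha) cs.
by exists C1, C2; split=> // -[//|n] _; exact: H.
Qed.

Lemma pa_norm1_cvg : exists2 kappa : R, 0 < kappa &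
  pa_norm a 1 n / n%:R `^ gam^-1 @[n --> \oo] --> kappa.
Proof.
have c1 : 0 < c + 1 by have := leaf_weight_gt0 ha; lra.
have [k k0 H] := prodr_affine_cvg (gamma_gt0 ha) (leaf_weight_gt0 ha) c1.
exists k => //; rewrite -(cvg_shiftn 1); move: H; rewrite mul1r.
rewrite (_ : [sequence _]_n = fun n => prodr_affine gam c 1 n / n.+1%:R `^ gam^-1) //.
by apply/funext => n; rewrite /= /pa_norm addn1.
Qed.

Lemma pa_fun_lower s : 0 < c + s -> exists2 C1 : R, 0 < C1 &
  forall j, C1 * j.+1%:R `^ s <= pa_fun a s j.
Proof.
move=> cs; have [C1 [C2 [C10 C20 H]]] := prodr_affine_bounds ltr01 (leaf_weight_gt0 ha) cs.
by exists C1 => // j; have /andP[+ _] := H j; rewrite divr1.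
Qed.

End AlmostSure.

Lemma powRD_gt0 (R : realType) (x r s : R) : 0 < x -> x `^ (r + s) = x `^ r * x `^ s.
Proof. by move=> x0; rewrite powRD // (gt_eqF x0) implybT. Qed.

Lemma ler_powR_base (R : realType) (x y r : R) : 0 <= r -> 0 <= x -> x <= y -> x `^ r <= y `^ r.
Proof. by move=> r0 x0 xy; apply: ge0_ler_powR; rewrite ?nnegrE // (le_trans x0). Qed.

Section AlmostSure.
Context d (Omega : measurableType d) (R : realType) (P : probability Omega R).
Variables (a : R) (par : nat -> {RV P >-> nat}).
Hypotheses (ha : -1 < a) (hpar : linear_pref_attachment a par).
Local Notation E := (tree_mean par).
Local Notation c := (1 + a).
Local Notation gam := (a + 2).
Local Notation th := (gam^-1).
Local Notation eta := (th ^+ 2 / 4).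

Lemma growth_exponent_gt0 : 0 < th. Proof. by rewrite invr_gt0 gamma_gt0. Qed.

Lemma growth_exponent_lt1 : th < 1.
Proof. by have := leaf_weight_gt0 ha => h; rewrite invf_lt1 ?gamma_gt0 //; lra. Qed.

(** The exponent [th / 2] is positive, so that later vertices lose a power of [n] in their degree,
    and smaller than [th], so that variances of order [n ^ (- th)] may be summed over the earlier
    vertices. *)
Definition threshold (n : nat) : nat := Num.truncn (n%:R `^ (th / 2)).

Lemma threshold_le n : (threshold n)%:R <= n%:R `^ (th / 2).
Proof. by rewrite truncn_le powR_ge0. Qed.

Lemma lt_threshold n : n%:R `^ (th / 2) < (threshold n).+1%:R.
Proof. by have /andP[] := truncn_itv (powR_ge0 (n%:R : R) (th / 2)). Qed.

Lemma threshold_mono m n : (m <= n)%N -> (threshold m <= threshold n)%N.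
Proof.
move=> mn; apply: le_truncn; apply: ler_powR_base => //; last by rewrite ler_nat.
by have := growth_exponent_gt0; lra.
Qed.

Lemma local_sum (I : Type) (r : seq I) n (F : I -> (nat -> nat) -> R) :
  (forall i, local n (F i)) -> local n (fun h => \sum_(i <- r) F i h).
Proof. by move=> Fl h h' hh; apply: eq_bigr => i _; exact: Fl. Qed.

Lemma late_degrees : \forall w \ae P, \forall n \near \oo, forall v,
  (threshold n <= v)%N -> (deg (tree par w) n v)%:R <= n%:R `^ (th - eta) :> R.
Proof.
have th0 := growth_exponent_gt0.
(* This [s] satisfies [s * eta = 3], so that the sum of at most [n] moments is
   of order [n ^ (- 2)]. *)
pose s := 12 / th ^+ 2.
have s0 : 0 < s by rewrite divr_gt0 // exprn_gt0.
have cs : 0 < c + s by rewrite addr_gt0 // leaf_weight_gt0.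
have [A A0 hA] := pa_fun_lower ha cs.
have [B1 [B2 [B10 B20 hB]]] := pa_norm_bounds ha cs.
pose q := s * (th - eta).
pose U n h := \sum_(threshold n <= v < n) pa_fun a s (deg h n v) / (A * n%:R `^ q).
have nR (n : nat) : (0 < n)%N -> (1 : R) <= n%:R by move=> n0; rewrite (ler_nat _ 1).
have U0 n h v : 0 <= pa_fun a s (deg h n v) / (A * n%:R `^ q).
  by rewrite divr_ge0 ?mulr_ge0 ?powR_ge0 // ltW ?pa_fun_gt0.
have : \forall w \ae P, \forall n \near \oo, U n (tree par w) <= 1.
  apply: (ae_eventually_le1 hpar (N := id) (C := 4 * (B2 / B1 / A))).
- move=> n; apply: local_sum => v h h' hh; rewrite (@pa_fun_local _ a s n v _ _ hh) //.
- by move=> n h _; apply: sumr_ge0 => v _; exact: U0.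
- move=> [|n].
    rewrite /U (_ : tree_mean _ _ _ = 0) ?expr1n ?divr1 ?mulr_ge0 ?invr_ge0
      ?(ltW A0) ?(ltW B10) ?(ltW B20) //.
    by rewrite /tree_mean big1 // => h _; rewrite big_geq // mul0r.
  set N : R := n.+1%:R; have N1 : 1 <= N by exact: nR.
  have N0 : 0 < N by apply: lt_le_trans N1.
  rewrite tree_mean_sum; apply: (@le_trans _ _
    (\sum_(threshold n.+1 <= v < n.+1) (B2 / B1 / A) * N `^ (- 3))).
    apply: ler_sum_nat => v /andP[tv vn].
    rewrite (_ : E _ _ = (A * N `^ q)^-1 * E n.+1 (fun h => pa_fun a s (deg h n.+1 v))); last first.
      by rewrite -tree_meanZ; apply: tree_mean_eq => h _; rewrite mulrC.
    rewrite (mean_pa_fun_born ha hpar cs vn).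
    have /andP[_ hn] := hB n.+1 isT; have /andP[hv _] := hB v.+1 isT.
    have V0 : 0 < B1 * v.+1%:R `^ (s / gam) by rewrite mulr_gt0 ?powR_gt0.
    have T : N `^ (th / 2 * (s / gam)) <= v.+1%:R `^ (s / gam).
      rewrite powRrM; apply: ler_powR_base; first by rewrite divr_ge0 ?ltW ?gamma_gt0.
        exact: powR_ge0.
      by apply: le_trans (ltW (lt_threshold _)) _; rewrite ler_nat ltnS.
    have N' r : 0 < N `^ r by exact: powR_gt0.
    apply: (@le_trans _ _ ((A * N `^ q)^-1 *
        (B2 * N `^ (s / gam) / (B1 * N `^ (th / 2 * (s / gam)))))).
      rewrite ler_pM2l ?invr_gt0 ?mulr_gt0 //; apply: ler_pM => //.
      - by rewrite ltW ?pa_norm_gt0.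
      - by rewrite invr_ge0 ltW ?pa_norm_gt0.
      rewrite lef_pV2 ?posrE ?pa_norm_gt0 ?mulr_gt0 //; apply: le_trans hv.
      by rewrite ler_pM2l.
    rewrite le_eqVlt; apply/orP; left; apply/eqP.
    (* Exponents of [N]: birth after the threshold gains [s * th ^ 2 / 2 = 6], the margin [eta] in
       the target gives back [s * eta = 3], and [3] are left. *)
    have -> : N `^ (s / gam) = N `^ (- 3) * (N `^ q * N `^ (th / 2 * (s / gam))).
      rewrite -!powRD_gt0 //; congr (_ `^ _); rewrite /q /s; field.
      by rewrite gt_eqF // gamma_gt0.
    by field; rewrite !gt_eqF.
  rewrite sumr_const_nat -[leLHS]mulr_natl.
  apply: (@le_trans _ _ (N * ((B2 / B1 / A) * N `^ (- 3)))).
    rewrite ler_wpM2r ?mulr_ge0 ?powR_ge0 ?divr_ge0 ?invr_ge0 ?(ltW A0) ?(ltW B10) ?(ltW B20) //.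
    by rewrite ler_nat leq_subr.
  have -> : N * (B2 / B1 / A * N `^ (- 3)) = B2 / B1 / A * (N ^+ 2)^-1.
    rewrite powRN (powR_mulrn 3) ?ltW //; field; rewrite !gt_eqF //.
  have : 0 < B2 / B1 / A by rewrite !divr_gt0.
  set K := B2 / B1 / A => K0; rewrite [4 * K]mulrC -[leRHS]mulrA ler_pM2l //.
  (* The required bound has the successor [N + 1] of the index in its denominator; the factor [4]
     covers [(N + 1) ^+ 2 <= 4 * N ^+ 2]. *)
  rewrite -natr1 -/N ler_pdivlMr ?exprn_gt0 ?addr_gt0 //.
  by rewrite mulrC ler_pdivrMr ?exprn_gt0 //; nra.
move=> AE; apply: filterS AE => w [n0 _ H]; exists (maxn n0 1) => // n /=.
rewrite geq_max => /andP[n0n n1] v tv.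
have [vn|nv] := ltnP v n; last by rewrite deg_unborn ?powR_ge0 //; exact: tree_recursive hpar _.
have N0 : 0 < n%:R :> R by rewrite ltr0n.
have := H n n0n; rewrite /U (bigD1_seq v) ?mem_index_iota ?tv ?iota_uniq //=.
set D := deg _ n v; set X := \sum_(_ <- _ | _) _ => H1.
have X0 : 0 <= X by apply: sumr_ge0 => u _; exact: U0.
have {}H1 : pa_fun a s D / (A * n%:R `^ q) <= 1 by apply: le_trans H1; rewrite lerDl.
move: H1; rewrite ler_pdivrMr ?mul1r ?mulr_gt0 ?powR_gt0 // => H1.
have := le_trans (hA D) H1; rewrite ler_pM2l // => H2.
apply: (@le_trans _ _ D.+1%:R); first by rewrite ler_nat.
have := ler_powR_base (ltW (_ : 0 < s^-1)) (powR_ge0 _ _) H2; rewrite invr_gt0 => /(_ s0).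
rewrite -!powRrM divff ?gt_eqF // powRr1 // /q mulrAC divff ?gt_eqF // mul1r.
exact.
Qed.

End AlmostSure.

(** Unborn vertices only add zeros, so the top degrees at two different times can be read off the
    same list of vertices, as [kth_largest_lipschitz] demands. *)
Lemma top_outdeg_iota (R : realType) (h : nat -> nat) (n N i : nat) :
  recursive_tree h -> (n <= N)%N ->
  (top_outdeg h n i)%:R = kth_largest [seq (deg h n v)%:R | v <- iota 0 N] i :> R.
Proof.
move=> hr nN; rewrite top_outdegE -[N](subnKC nN) iotaD map_cat kth_largest_pad.
- rewrite -val_enum_ord -map_comp; congr (kth_largest _ _).
  by apply: eq_map => v /=; rewrite degE.
- by apply/allP => _ /mapP[v _ ->].
apply/allP => _ /mapP[v + ->]; rewrite add0n mem_iota => /andP[nv _].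
by rewrite /= deg_unborn.
Qed.

Lemma top_outdeg_mono (R : realType) (h : nat -> nat) (i m n : nat) :
  recursive_tree h -> (m <= n)%N -> (top_outdeg h m i)%:R <= (top_outdeg h n i)%:R :> R.
Proof.
move=> hr mn; rewrite (top_outdeg_iota R i hr mn) (top_outdeg_iota R i hr (leqnn n)).
rewrite -[leRHS]addr0; apply: kth_largest_le => // v _.
by rewrite addr0 ler_nat deg_le.
Qed.

Section AlmostSure.
Context d (Omega : measurableType d) (R : realType) (P : probability Omega R).
Variables (a : R) (par : nat -> {RV P >-> nat}).
Hypotheses (ha : -1 < a) (hpar : linear_pref_attachment a par).
Local Notation E := (tree_mean par).
Local Notation c := (1 + a).
Local Notation gam := (a + 2).
Local Notation th := (gam^-1).
Local Notation eta := (th ^+ 2 / 4).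
Local Notation threshold := (threshold a).
Variable K : nat.
Hypothesis hK : 12 * gam <= K%:R.
Local Notation time j := (j.+1 ^ K)%N.

Lemma time_exponent_ge : 12 <= K%:R * th.
Proof. by rewrite ler_pdivlMr ?gamma_gt0. Qed.

Lemma time_exponent_gt0 : (0 < K)%N.
Proof.
by rewrite -(ltr0n R); apply: lt_le_trans hK; rewrite mulr_gt0 ?gamma_gt0.
Qed.

Lemma time_powR (j : nat) (r : R) : (time j)%:R `^ r = j.+1%:R `^ (K%:R * r).
Proof. by rewrite natrX -powR_mulrn // -powRrM. Qed.

Lemma time_gt0 j : (0 < time j)%N. Proof. by rewrite expn_gt0. Qed.

Lemma time_le j : (time j <= time j.+1)%N.
Proof. by rewrite leq_exp2r ?time_exponent_gt0. Qed.

(** The vertices below the threshold of the next time are thus already born now, and their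
    martingales have started. The threshold is at most a square root, and [j + 2 <= (j + 1) ^ 2]. *)
Lemma threshold_time j : (0 < j)%N -> (threshold (time j.+1) <= time j)%N.
Proof.
move=> j0; rewrite -(ler_nat R); apply: le_trans (threshold_le _ _) _.
have th0 := growth_exponent_gt0 ha; have th1 := growth_exponent_lt1 ha.
have n1 : (1 : R) <= (time j.+1)%:R by rewrite (ler_nat _ 1) time_gt0.
apply: (@le_trans _ _ ((time j.+1)%:R `^ (2^-1))).
  by apply: ler_powR => //; lra.
have -> : (time j)%:R = ((time j)%:R ^+ 2) `^ 2^-1 :> R.
  by rewrite -powR_mulrn // -powRrM divff // powRr1.
apply: ler_powR_base; rewrite ?invr_ge0 // -natrX ler_nat -expnM mulnC expnM.
by rewrite leq_exp2r ?time_exponent_gt0 // expnS expn1; nia.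
Qed.

(** About [J ^ (K th / 2)] vertices, each with an increment of variance [O(J ^ (- K th))], give a
    sum [O(J ^ (- 6))] since [K th >= 12]. Four of these powers pay for the squared rate
    [J ^ (- 2)], the other two for Borel-Cantelli. *)
Lemma mart_increments : \forall w \ae P, \forall j \near \oo, forall v,
  (v < threshold (time j.+1))%N -> (v < time j)%N ->
  `|pa_mart a (time j.+1) v (tree par w) - pa_mart a (time j) v (tree par w)| <=
  (j.+1%:R ^+ 2)^-1.
Proof.
have th0 := growth_exponent_gt0 ha; have c0 := leaf_weight_gt0 ha.
have c1 : 0 < c + 1 by lra.
have [B1 [B2 [B10 _ hB]]] := pa_norm_bounds ha c1.
pose D j v h := pa_mart a (time j.+1) v h - pa_mart a (time j) v h.
pose U j h := \sum_(0 <= v < minn (threshold (time j.+1)) (time j))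
  j.+1%:R ^+ 4 * D j v h ^+ 2.
pose C := 2 `^ (K%:R * (th / 2)) / (c * B1).
have C0 : 0 <= C by rewrite divr_ge0 ?powR_ge0 // mulr_ge0 // ltW.
have : \forall w \ae P, \forall j \near \oo, U j (tree par w) <= 1.
  apply: (ae_eventually_le1 hpar (N := fun j => time j.+1) (C := C)).
  - move=> j; apply: local_sum => v h h' hh; rewrite /D /pa_mart.
    rewrite (@pa_fun_local _ a 1 (time j.+1) v _ _ hh).
    by rewrite (local_le (time_le j) (@pa_fun_local _ a 1 (time j) v) hh).
  - by move=> j h _; apply: sumr_ge0 => v _; rewrite mulr_ge0 ?sqr_ge0 // exprn_ge0.
  move=> j; rewrite tree_mean_sum; set J : R := j.+1%:R.
  have J1 : 1 <= J by rewrite (ler_nat _ 1).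
  have J0 : 0 < J by apply: lt_le_trans J1.
  have JK r : 0 < J `^ r by exact: powR_gt0.
  apply: (@le_trans _ _ (\sum_(0 <= v < minn (threshold (time j.+1)) (time j))
      J ^+ 4 / (c * (B1 * J `^ (K%:R * th))))).
    apply: ler_sum_nat => v /andP[_]; rewrite leq_min => /andP[_ vm].
    rewrite tree_meanZ ler_pM2l ?exprn_gt0 //.
    apply: le_trans (pa_mart_increment ha hpar vm (time_le j)) _.
    rewrite lef_pV2 ?posrE ?mulr_gt0 ?pa_norm_gt0 // ler_pM2l //.
    have /andP[+ _] := hB (time j) (time_gt0 j).
    by rewrite mul1r time_powR.
  rewrite sumr_const_nat subn0 -[leLHS]mulr_natl.
  apply: (@le_trans _ _ (2 `^ (K%:R * (th / 2)) * J `^ (K%:R * (th / 2)) *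
      (J ^+ 4 / (c * (B1 * J `^ (K%:R * th)))))).
    rewrite ler_wpM2r ?divr_ge0 ?exprn_ge0 ?mulr_ge0 ?(ltW c0) ?(ltW B10) ?powR_ge0 ?(ltW J0) //.
    apply: (@le_trans _ _ (threshold (time j.+1))%:R); first by rewrite ler_nat geq_minl.
    (* The power of [2] in [C] comes from [j.+2 <= 2 * j.+1], which brings the next time back to
       [J]. *)
    apply: le_trans (threshold_le _ _) _; rewrite time_powR -powRM ?(ltW J0) //.
    apply: ler_powR_base => //; first by rewrite mulr_ge0 // divr_ge0 // ltW.
    by rewrite -natr1 -/J; lra.
  have -> : J `^ (K%:R * th) = J `^ (K%:R * (th / 2)) * J `^ (K%:R * (th / 2)).
    by rewrite -powRD_gt0 //; congr (_ `^ _); field; rewrite gt_eqF // gamma_gt0.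
  have J6 : J ^+ 6 <= J `^ (K%:R * (th / 2)).
    by rewrite -powR_mulrn ?(ltW J0) //; apply: ler_powR => //; have := time_exponent_ge; lra.
  set x := J `^ (K%:R * (th / 2)) in J6 *.
  have x0 : 0 < x by exact: JK.
  have -> : 2 `^ (K%:R * (th / 2)) * x * (J ^+ 4 / (c * (B1 * (x * x)))) = C * (J ^+ 4 / x).
    by rewrite /C; field; rewrite !gt_eqF.
  apply: ler_wpM2l => //; rewrite ler_pdivrMr // mulrC ler_pdivlMr ?exprn_gt0 //.
  by rewrite -exprD.
move=> AE; apply: filterS AE => w [j0 _ H]; exists j0 => // j /= j0j v vt vm.
have := H j j0j; rewrite /U (bigD1_seq v) ?mem_index_iota ?leq_min ?vt ?vm ?iota_uniq //=.
set X := \sum_(_ <- _ | _) _ => H1.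
have J0 : (0 : R) < j.+1%:R by [].
have X0 : 0 <= X by apply: sumr_ge0 => u _; rewrite mulr_ge0 ?sqr_ge0 // exprn_ge0.
have {}H1 : j.+1%:R ^+ 4 * D j v (tree par w) ^+ 2 <= 1.
  by apply: le_trans H1; rewrite lerDl.
rewrite -/(D j v (tree par w)) -(ler_pXn2r (ltn0Sn 1)) ?nnegrE ?invr_ge0 ?exprn_ge0 //.
rewrite real_normK ?num_real // -ler_pdivlMl ?exprn_gt0 // mulr1 in H1 *.
by apply: le_trans H1 _; rewrite -exprVn -exprM exprVn.
Qed.

End AlmostSure.

(** * Convergence of the top degrees *)

Lemma natS_ratio_cvg (R : realType) (r : R) :
  (j.+2%:R / j.+1%:R) `^ r @[j --> \oo] --> (1 : R).
Proof.
rewrite (_ : (fun j => _) = fun j : nat => expR (r * ln (1 + harmonic j))); last first.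
  apply/funext => j; rewrite /powR (_ : _ == 0 = false); last by rewrite gt_eqF.
  by congr (expR (r * ln _)); rewrite /harmonic -natr1 mulrDl divff // div1r.
rewrite -[X in _ --> X]expR0; apply: continuous_cvg; first exact: continuous_expR.
rewrite -(mulr0 r); apply: cvgMr; rewrite -(@ln1 R).
apply: continuous_cvg; first exact: continuous_ln.
by rewrite -[X in _ --> X]addr0; apply: cvgD; [exact: cvg_cst|exact: cvg_harmonic].
Qed.

(** Between two consecutive times of the subsequence, monotonicity bounds the normalised sequence by
    [l j] and [U j], the values at the ends with the normalisations exchanged; the ratio of
    consecutive normalisations tends to [1]. *)
Lemma power_interpolation (R : realType) (K : nat) (r : R) (u : R^nat) (x : R) :
  (0 < K)%N -> 0 <= r -> (forall n, 0 <= u n) -> {homo u : m n / (m <= n)%N >-> m <= n} ->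
  u (j.+1 ^ K)%N / (j.+1 ^ K)%:R `^ r @[j --> \oo] --> x ->
  u n / n%:R `^ r @[n --> \oo] --> x.
Proof.
move=> K0 r0 u0 um ux; pose q (j : nat) : R := (j.+2%:R / j.+1%:R) `^ (K%:R * r).
have qc : q @ \oo --> (1 : R) by exact: natS_ratio_cvg.
have tE j s : (j.+1 ^ K)%:R `^ s = j.+1%:R `^ (K%:R * s) :> R.
  by rewrite natrX -powR_mulrn // -powRrM.
have w0 (j : nat) : 0 < j.+1%:R `^ (K%:R * r) :> R by exact: powR_gt0.
have qE j : q j * j.+1%:R `^ (K%:R * r) = j.+2%:R `^ (K%:R * r).
  by rewrite /q -powRM ?divr_ge0 // divfK.
pose l j := u (j.+1 ^ K)%N / j.+2%:R `^ (K%:R * r).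
pose U j := u (j.+2 ^ K)%N / j.+1%:R `^ (K%:R * r).
have lx : l @ \oo --> x.
  rewrite (_ : l = fun j => (u (j.+1 ^ K)%N / (j.+1 ^ K)%:R `^ r) / q j).
    by rewrite -[x]divr1; apply: cvgM => //; apply: cvgV.
  by apply/funext => j; rewrite tE -mulrA -invfM mulrC [_ * q j]mulrC qE mulrC.
have Ux : U @ \oo --> x.
  rewrite (_ : U = fun j => (u (j.+2 ^ K)%N / (j.+2 ^ K)%:R `^ r) * q j).
    rewrite -[x]mulr1; apply: cvgM => //.
    by move: ux; rewrite -(cvg_shiftn 1) /=; under [X in X -> _]eq_cvg do rewrite addn1.
  apply/funext => j; rewrite tE -qE invfM /U -mulrA; congr (_ * _).
  by rewrite mulrAC mulVf ?mul1r // gt_eqF // /q powR_gt0 // divr_gt0.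
apply/cvgrPdist_lt => e e0.
have /cvgrPdist_lt/(_ e e0)[J1 _ h1] := lx.
have /cvgrPdist_lt/(_ e e0)[J2 _ h2] := Ux.
pose J := maxn J1 J2; exists (J.+1 ^ K)%N => // n /= Jn.
have n0 : (0 < n)%N by apply: leq_trans Jn; rewrite expn_gt0.
have ex : exists j, (n < j.+2 ^ K)%N.
  exists n; apply: (@leq_trans (n.+2 ^ 1)); first by rewrite expn1.
  by rewrite leq_exp2l.
pose j := ex_minn ex.
have [jn jmin] : (n < j.+2 ^ K)%N /\ forall i, (n < i.+2 ^ K)%N -> (j <= i)%N.
  by rewrite /j; case: ex_minnP.
have nj : (j.+1 ^ K <= n)%N.
  case: j jn jmin => [|j] jn jmin; first by rewrite exp1n.
  by rewrite leqNgt; apply/negP => /jmin; rewrite ltnn.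
have Jj : (J <= j)%N.
  rewrite leqNgt; apply/negP => jJ; have := leq_ltn_trans Jn jn.
  by rewrite ltnNge => /negP; apply; rewrite leq_exp2r.
have nr0 : 0 < n%:R `^ r :> R by rewrite powR_gt0 // ltr0n.
have lo : l j <= u n / n%:R `^ r.
  apply: ler_pM; rewrite ?u0 ?invr_ge0 ?powR_ge0 ?um //.
  rewrite lef_pV2 ?posrE ?powR_gt0 ?ltr0n // -tE; apply: ler_powR_base => //.
  by rewrite ler_nat ltnW.
have hi : u n / n%:R `^ r <= U j.
  apply: ler_pM; rewrite ?u0 ?invr_ge0 ?powR_ge0 ?um ?(ltnW jn) //.
  rewrite lef_pV2 ?posrE ?powR_gt0 ?ltr0n // -tE; apply: ler_powR_base => //.
  by rewrite ler_nat.
have := h1 j (leq_trans (leq_maxl _ _) Jj); have := h2 j (leq_trans (leq_maxr _ _) Jj).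
rewrite /= !ltr_norml => /andP[a1 a2] /andP[a3 a4]; apply/andP; split; lra.
Qed.

Section Deterministic.
Variables (R : realType) (a : R) (ha : -1 < a).
Local Notation c := (1 + a).
Local Notation gam := (a + 2).
Local Notation th := (gam^-1).
Local Notation eta := (th ^+ 2 / 4).
Local Notation threshold := (threshold a).
Variable K : nat.
Hypothesis hK : 12 * gam <= K%:R.
Hypothesis hKeta : 2 <= K%:R * eta.
Local Notation time j := (j.+1 ^ K)%N.
Variable h : nat -> nat.
Hypothesis hr : recursive_tree h.
Hypothesis late : \forall n \near \oo, forall v,
  (threshold n <= v)%N -> (deg h n v)%:R <= n%:R `^ (th - eta) :> R.
Hypothesis incr : \forall j \near \oo, forall v,
  (v < threshold (time j.+1))%N -> (v < time j)%N ->
  `|pa_mart a (time j.+1) v h - pa_mart a (time j) v h| <= (j.+1%:R ^+ 2)^-1.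

(** By the Lipschitz property it is enough that each scaled degree moves by at most [C / j ^ 2]. The
    three terms of [C] account for the martingale increment, the change of the shift
    [(pa_norm a 1 m)^-1], and the degrees of late vertices. *)
Lemma top_outdeg_time_cvg i :
  cvgn (fun j => (top_outdeg h (time j) i)%:R / (c * pa_norm a 1 (time j)) : R).
Proof.
have th0 := growth_exponent_gt0 ha; have c0 := leaf_weight_gt0 ha; have c1 : 0 < c + 1 by lra.
have [B1 [B2 [B10 _ hB]]] := pa_norm_bounds ha c1.
have pn0 n := pa_norm_gt0 ha n c1.
pose C : R := 1 + B1^-1 + (c * B1)^-1.
apply: (@cvgn_quadratic_increments _ _ C).
case: late => n0 _ hl; case: incr => j0 _ hi.
exists (maxn n0.+1 j0) => // j /=; rewrite geq_max => /andP[n0j j0j].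
have j1 : (0 < j)%N by apply: leq_trans n0j.
set m := time j; set n := time j.+1.
have mn : (m <= n)%N by exact: (time_le ha hK j).
have jm : (j.+1 <= m)%N.
  by rewrite -[leqLHS]expn1; apply: leq_pexp2l => //; exact: (time_exponent_gt0 ha hK).
have n0m : (n0 <= m)%N by apply: leq_trans jm; rewrite ltnW // ltnW.
have hlm := hl m n0m; have hln := hl n (leq_trans n0m mn).
rewrite (top_outdeg_iota R i hr mn) (top_outdeg_iota R i hr (leqnn n)).
rewrite mulrC -kth_largestZ ?invr_gt0 ?mulr_gt0 // [kth_largest _ _ / _]mulrC.
rewrite -kth_largestZ ?invr_gt0 ?mulr_gt0 // -!map_comp.
set J : R := j.+1%:R; have J1 : 1 <= J by rewrite (ler_nat _ 1).
have J0 : 0 < J by apply: lt_le_trans J1.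
have JV : 0 < (J ^+ 2)^-1 by rewrite invr_gt0 exprn_gt0.
have nm : (m%:R : R) <= n%:R by rewrite ler_nat.
have m0 : (0 < m)%N by exact: time_gt0.
have mR : 0 < m%:R :> R by rewrite ltr0n.
have nR : 0 < n%:R :> R by apply: lt_le_trans nm.
have mth : J ^+ 2 <= m%:R `^ th.
  rewrite /m time_powR -powR_mulrn ?(ltW J0) //; apply: ler_powR => //.
  by have := time_exponent_ge ha hK; lra.
have meta : J ^+ 2 <= m%:R `^ eta.
  by rewrite /m time_powR -powR_mulrn ?(ltW J0) //; apply: ler_powR.
have pm : B1 * J ^+ 2 <= pa_norm a 1 m.
  have /andP[+ _] := hB m m0; rewrite mul1r; apply: le_trans.
  by rewrite ler_pM2l.
have pV : (pa_norm a 1 m)^-1 <= B1^-1 * (J ^+ 2)^-1.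
  by rewrite -invfM lef_pV2 ?posrE ?mulr_gt0 ?exprn_gt0.
have tailE k v : (m <= k)%N -> (deg h k v)%:R <= k%:R `^ (th - eta) ->
    (c * pa_norm a 1 k)^-1 * (deg h k v)%:R <= (c * B1)^-1 * (J ^+ 2)^-1.
  move=> mk hkv; have k0 : (0 < k)%N by exact: leq_trans mk.
  have kR : 0 < k%:R :> R by rewrite ltr0n.
  have e0 : 0 <= eta by rewrite divr_ge0 // exprn_ge0 // ltW.
  have keta : J ^+ 2 <= k%:R `^ eta.
    by apply: le_trans meta _; apply: ler_powR_base; rewrite ?ler_nat.
  have /andP[kB _] := hB k k0; rewrite mul1r in kB.
  have kth0 : 0 < k%:R `^ th :> R by rewrite powR_gt0.
  have ket0 : 0 < k%:R `^ eta :> R by rewrite powR_gt0.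
  rewrite powRD_gt0 // powRN in hkv.
  apply: (@le_trans _ _ ((c * (B1 * k%:R `^ th))^-1 * (k%:R `^ th / k%:R `^ eta))).
    apply: ler_pM; rewrite ?invr_ge0 ?mulr_ge0 ?(ltW c0) ?(ltW (pn0 _)) //.
    by rewrite lef_pV2 ?posrE ?mulr_gt0 // ler_pM2l.
  have -> : (c * (B1 * k%:R `^ th))^-1 * (k%:R `^ th / k%:R `^ eta) =
    (c * B1)^-1 * (k%:R `^ eta)^-1 by field; rewrite !gt_eqF.
  by rewrite ler_pM2l ?invr_gt0 ?mulr_gt0 // lef_pV2 ?posrE ?exprn_gt0.
apply: kth_largest_lipschitz => [|v _ /=].
  by rewrite mulr_ge0 ?(ltW JV) // !addr_ge0 // invr_ge0 ?mulr_ge0 // ltW.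
have CE : C / J ^+ 2 = (J ^+ 2)^-1 + B1^-1 * (J ^+ 2)^-1 + (c * B1)^-1 * (J ^+ 2)^-1.
  by rewrite /C [LHS]mulrDl [X in X + _]mulrDl mul1r.
have [vt|tv] := ltnP v (threshold n).
  have vm : (v < m)%N by apply: leq_trans vt _; exact: (threshold_time ha hK j1).
  (* The martingale is built on [deg + c], hence the scaled degree differs from it by a vanishing
     shift common to all vertices. *)
  have D k : (c * pa_norm a 1 k)^-1 * (deg h k v)%:R =
      pa_mart a k v h - (pa_norm a 1 k)^-1.
    by rewrite /pa_mart pa_fun1E //; field; rewrite !gt_eqF.
  rewrite !D; have := hi j j0j v vt vm; rewrite -/m -/n -/J.
  have nV : (pa_norm a 1 n)^-1 <= (pa_norm a 1 m)^-1.
    by rewrite lef_pV2 ?posrE // pa_norm1_le.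
  have nV0 : 0 <= (pa_norm a 1 n)^-1 by rewrite invr_ge0 ltW.
  have e0 : 0 <= (c * B1)^-1 * (J ^+ 2)^-1.
    by rewrite mulr_ge0 ?(ltW JV) // invr_ge0 mulr_ge0 // ltW.
  rewrite CE !ler_norml.
  move: (J ^+ 2)^-1 (pa_mart a n v h) (pa_mart a m v h) (pa_norm a 1 n)^-1
    (pa_norm a 1 m)^-1 (B1^-1 * (J ^+ 2)^-1) ((c * B1)^-1 * (J ^+ 2)^-1) pV nV nV0 e0.
  move=> e3 M1 M2 p1 p2 e1 e2 pV nV nV0 e0 /andP[h1 h2]; apply/andP; split; lra.
have t1 := tailE n v mn (hln v tv).
have t2 := tailE m v (leqnn _) (hlm v (leq_trans (threshold_mono ha mn) tv)).
have q1 : 0 <= (c * pa_norm a 1 n)^-1 * (deg h n v)%:R.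
  by rewrite mulr_ge0 // invr_ge0 mulr_ge0 // ltW.
have q2 : 0 <= (c * pa_norm a 1 m)^-1 * (deg h m v)%:R.
  by rewrite mulr_ge0 // invr_ge0 mulr_ge0 // ltW.
have e0 : 0 <= B1^-1 * (J ^+ 2)^-1 by rewrite mulr_ge0 ?(ltW JV) // invr_ge0 ltW.
rewrite CE ler_norml.
move: (J ^+ 2)^-1 ((c * pa_norm a 1 n)^-1 * (deg h n v)%:R)
  ((c * pa_norm a 1 m)^-1 * (deg h m v)%:R)
  (B1^-1 * (J ^+ 2)^-1) ((c * B1)^-1 * (J ^+ 2)^-1) t1 t2 q1 q2 e0 JV.
move=> e3 d1 d2 e1 e2 t1 t2 q1 q2 e0 JV; apply/andP; split; lra.
Qed.

Lemma top_outdeg_cvg i : cvgn (fun n => (top_outdeg h n i)%:R / n%:R `^ th : R).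
Proof.
have th0 := growth_exponent_gt0 ha; have c0 := leaf_weight_gt0 ha; have c1 : 0 < c + 1 by lra.
have pn0 n := pa_norm_gt0 ha n c1.
have [k k0 hk] := pa_norm1_cvg ha.
have /cvg_ex[x hx] := @top_outdeg_time_cvg i.
apply/cvg_ex; exists (x * (c * k)).
apply: (@power_interpolation _ K) => //; first exact: (time_exponent_gt0 ha hK).
- exact: ltW.
- by move=> m n mn; exact: top_outdeg_mono.
have hk' : pa_norm a 1 (time j) / (time j)%:R `^ th @[j --> \oo] --> k.
  apply: (cvg_comp (fun j => time j) _ _ hk).
  apply/cvgnyPge => A; near=> j; apply: (@leq_trans j.+1).
    by apply: leqW; near: j; exact: nbhs_infty_ge.
  by rewrite -[leqLHS]expn1; apply: leq_pexp2l => //; exact: (time_exponent_gt0 ha hK).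
have -> : (fun j => (top_outdeg h (time j) i)%:R / (time j)%:R `^ th : R) =
  (fun j => (top_outdeg h (time j) i)%:R / (c * pa_norm a 1 (time j)) *
    (c * (pa_norm a 1 (time j) / (time j)%:R `^ th))).
  apply/funext => j; field; rewrite !gt_eqF // powR_gt0 // ltr0n; exact: time_gt0.
by apply: cvgM => //; apply: cvgMr.
Unshelve. all: by end_near. Qed.

End Deterministic.

(** * Positivity of the limits *)

(** The first [i.+1] vertices cannot all exceed the value of rank [i]. A top degree is thus bounded
    below by the minimum over a fixed finite set of vertices, to which a fixed sum of moments
    applies. *)
Lemma top_outdeg_min (R : realType) (h : nat -> nat) (n i : nat) :
  recursive_tree h -> (i < n)%N ->
  exists2 v, (v <= i)%N & (deg h n v <= top_outdeg h n i)%N.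
Proof.
move=> hr hin; apply: contrapT => H.
have lt v : (v <= i)%N -> (top_outdeg h n i < deg h n v)%N.
  by move=> vi; rewrite ltnNge; apply/negP => le; apply: H; exists v.
have := ltxx ((top_outdeg h n i)%:R : R); set x := {1}(_%:R).
rewrite (top_outdeg_iota R i hr (leqnn n)).
rewrite (@kth_largest_count _ (> x)) ?size_map ?size_iota //; last first.
  by move=> y z yz xy; exact: lt_le_trans yz.
move=> /negbT; rewrite -leqNgt => /negP; apply; apply/negP; rewrite -ltnNge.
rewrite -[n in iota 0 n](subnKC hin) iotaD map_cat count_cat.
apply: leq_trans (leq_addr _ _); rewrite count_map.
have -> : count (preim (fun v => (deg h n v)%:R) (> x)) (iota 0 i.+1) = i.+1.
  apply/eqP; rewrite -[X in _ == X](size_iota 0 i.+1) -all_count; apply/allP => v.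
  by rewrite mem_iota add0n => /andP[_ vi] /=; rewrite /x ltr_nat lt.
by [].
Qed.

Section Positivity.
Context d (Omega : measurableType d) (R : realType) (P : probability Omega R).

Lemma ae_not_cvgy (f : nat -> Omega -> R) (C : R) :
  (forall n, measurable_fun setT (f n)) -> (forall n w, 0 <= f n w) ->
  (forall n, (\int[P]_w (f n w)%:E <= C%:E)%E) ->
  \forall w \ae P, ~ (f n w @[n --> \oo] --> +oo).
Proof.
move=> mf f0 fC.
pose g w : \bar R := limn_einf (fun n => (f n w)%:E).
have g0 w : (0 <= g w)%E.
  rewrite /g limn_einf_lim; apply: lime_ge; first exact: is_cvg_einfs.
  by apply: nearW => n; apply: le_ereal_inf_tmp => _ [m _ <-]; rewrite lee_fin.
have mg : measurable_fun setT g.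
  rewrite /g /limn_einf; apply: measurableT_comp => //.
  apply: measurable_fun_limn_esup => n; apply: measurableT_comp => //.
  exact/measurable_EFinP.
have ig : P.-integrable setT g.
  apply/integrableP; split => //; under eq_integral do rewrite gee0_abs //.
  apply: (@le_lt_trans _ _ C%:E); last by rewrite ltry.
  apply: (@le_trans _ _ (limn_einf (fun n => \int[P]_w (f n w)%:E)%E)).
    apply: fatou => [//|n|n w _]; last by rewrite lee_fin.
    have : measurable_fun setT (EFin \o f n) by exact/measurable_EFinP.
    exact.
  rewrite limn_einf_lim; apply: lime_le; first exact: is_cvg_einfs.
  apply: nearW => n; apply: le_trans (fC n); apply: ereal_inf_lbound.
  by exists n => /=.
have := integrable_ae measurableT ig; apply: filterS => w /(_ I) gfin fy.
have /cvg_limn_einf_sup[+ _] : (f n w)%:E @[n --> \oo] --> +oo%E.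
  exact/cvgeryP.
by move=> gy; move: gfin; rewrite /g gy.
Qed.

Variables (a : R) (par : nat -> {RV P >-> nat}).
Hypotheses (ha : -1 < a) (hpar : linear_pref_attachment a par).
Local Notation c := (1 + a).
Local Notation gam := (a + 2).
Local Notation th := (gam^-1).

(** If the limit were [0], the smallest scaled degree among the first [i.+1] vertices would tend to
    [0], and its negative power [s] would drive [U] to infinity. But the mean of [U] is bounded, as
    the power of [n] in it compensates [pa_norm]. Any [s] strictly between [- c] and [0] would
    do. *)
Lemma top_outdeg_limit_neq0 i : \forall w \ae P,
  ~ ((top_outdeg (tree par w) n i)%:R / n%:R `^ th @[n --> \oo] --> (0 : R)).
Proof.
have th0 := growth_exponent_gt0 ha; have c0 := leaf_weight_gt0 ha.
pose s := - (c / 2); have s0 : s < 0 by rewrite /s; lra.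
have cs : 0 < c + s by rewrite /s; lra.
have [A A0 hA] := pa_fun_lower ha cs.
have [B1 [B2 [B10 B20 hB]]] := pa_norm_bounds ha cs.
pose U n h := \sum_(0 <= v < i.+1) n%:R `^ (- (s / gam)) * pa_fun a s (deg h n v).
have Ul n : local n (U n).
  by apply: local_sum => v h h' hh; rewrite (@pa_fun_local _ a s n v _ _ hh).
have pf0 j : 0 < pa_fun a s j by exact: pa_fun_gt0.
(* The shift of the index ensures that the vertices [0, .., i] are all born. *)
have : \forall w \ae P, ~ (U (n + i.+1)%N (tree par w) @[n --> \oo] --> +oo).
  apply: (@ae_not_cvgy (fun n w => U (n + i.+1)%N (tree par w))
     (\sum_(0 <= v < i.+1) B2 / pa_norm a s v.+1)).
  - move=> n; exact: measurable_tree hpar _ _ (Ul _).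
  - by move=> n w; apply: sumr_ge0 => v _; rewrite mulr_ge0 ?powR_ge0 // ltW.
  move=> n; set N := (n + i.+1)%N.
  rewrite (integral_tree hpar (Ul N)) lee_fin tree_mean_sum.
  apply: ler_sum_nat => v /andP[_ vi]; rewrite tree_meanZ.
  have vN : (v < N)%N by apply: leq_trans vi _; rewrite leq_addl.
  have N0 : (0 < N)%N by apply: leq_ltn_trans vN.
  rewrite (mean_pa_fun_born ha hpar cs vN) mulrA ler_pM2r ?invr_gt0 ?pa_norm_gt0 //.
  have /andP[_ hN] := hB N N0; rewrite powRN mulrC ler_pdivrMr // powR_gt0 //.
  by rewrite ltr0n.
apply: filterS => w NU topc; apply: NU.
rewrite (cvg_shiftn i.+1 (fun n => U n (tree par w))).
have hr : recursive_tree (tree par w) by exact: tree_recursive hpar w.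
apply/cvgryPge => M.
have [M0|M0] := leP M 0.
  apply: nearW => n; apply: le_trans M0 _; apply: sumr_ge0 => v _.
  by rewrite mulr_ge0 ?powR_ge0 // ltW.
pose e := (M / A) `^ s^-1.
have e0 : 0 < e by rewrite powR_gt0 // divr_gt0.
have es : A * e `^ s = M.
  rewrite -powRrM mulVf ?lt_eqF // powRr1 ?(ltW (divr_gt0 M0 A0)) //.
  by rewrite mulrC divfK // gt_eqF.
have e2 : 0 < e / 2 by rewrite divr_gt0.
have /cvgrPdist_lt/(_ _ e2) htop := topc.
near=> n.
have n0 : (0 < n)%N by near: n; exists 1%N.
have ni : (i < n)%N by near: n; exists i.+1.
have nth0 : 0 < n%:R `^ th :> R by rewrite powR_gt0 // ltr0n.
have h1 : (top_outdeg (tree par w) n i)%:R / n%:R `^ th < e / 2.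
  have : `|0 - (top_outdeg (tree par w) n i)%:R / n%:R `^ th| < e / 2 by near: n.
  by rewrite sub0r normrN ger0_norm // divr_ge0 // ltW.
have h2 : (n%:R `^ th)^-1 <= e / 2 :> R.
  rewrite -[leRHS]invrK lef_pV2 ?posrE ?invr_gt0 //.
  apply: (@le_trans _ _ (((e / 2)^-1 `^ gam) `^ th)).
    by rewrite -powRrM divff ?gt_eqF ?gamma_gt0 // powRr1 // invr_ge0 ltW.
  apply: ler_powR_base; [exact: ltW|exact: powR_ge0|near: n; exact: nbhs_infty_ger].
have [v vi vtop] := top_outdeg_min R hr ni.
have h3 : (deg (tree par w) n v).+1%:R / n%:R `^ th <= e.
  apply: (@le_trans _ _ ((top_outdeg (tree par w) n i)%:R / n%:R `^ th + (n%:R `^ th)^-1)).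
    rewrite -natr1 mulrDl div1r lerD2r ler_pM2r ?invr_gt0 // ler_nat //.
  by apply: le_trans (lerD (ltW h1) h2) _; lra.
apply: (@le_trans _ _ (n%:R `^ (- (s / gam)) * pa_fun a s (deg (tree par w) n v))); last first.
  rewrite /U [leRHS](bigD1_seq v) ?mem_index_iota ?iota_uniq ?ltnS //=.
  by rewrite lerDl sumr_ge0 // => u _; rewrite mulr_ge0 ?powR_ge0 // ltW.
apply: (@le_trans _ _ (n%:R `^ (- (s / gam)) *
    (A * (deg (tree par w) n v).+1%:R `^ s))); last first.
  by rewrite ler_wpM2l ?powR_ge0.
rewrite mulrCA -es ler_pM2l //.
have -> : n%:R `^ (- (s / gam)) * (deg (tree par w) n v).+1%:R `^ s =
   ((deg (tree par w) n v).+1%:R / n%:R `^ th) `^ s :> R.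
  rewrite powRM ?invr_ge0 ?powR_ge0 // mulrC; congr (_ * _).
  rewrite -[in RHS]powRN -powRrM; congr (_ `^ _). by rewrite [RHS]mulNr [X in _ = - X]mulrC.
have x0 : 0 < (deg (tree par w) n v).+1%:R / n%:R `^ th :> R by rewrite divr_gt0.
have [r r0 ->] : exists2 r, 0 <= r & s = - r by exists (- s); rewrite ?opprK //; lra.
rewrite !powRN lef_pV2 ?posrE ?(powR_gt0 _ e0) ?(powR_gt0 _ x0) //.
by apply: ler_powR_base; rewrite ?(ltW x0).
Unshelve. all: by end_near. Qed.

End Positivity.

(** * Convergence in distribution *)

Lemma cvg_row (R : realType) (k : nat) (u : nat -> 'rV[R]_k) (l : 'rV[R]_k) :
  (forall i, u n 0 i @[n --> \oo] --> l 0 i) -> u n @[n --> \oo] --> l.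
Proof.
move=> ul; apply/cvg_ballP => e e0.
have : \forall n \near \oo, forall i : 'I_k, ball (l 0 i) e (u n 0 i).
  by apply: filter_forall => i; have /cvg_ballP := ul i; exact.
apply: filterS => n H; split=> // i j; rewrite !ord1; exact: H.
Qed.

Lemma measurable_fun_in_set (d : measure_display) (T : measurableType d) (N : set T) :
  measurable N -> measurable_fun setT (fun w => w \in N).
Proof.
move=> mN; apply: (measurable_fun_bool true).
rewrite setTI (_ : _ @^-1` _ = N) //; apply/seteqP; split=> w; [exact: set_mem|exact: mem_set].
Qed.

(** Dominated convergence, with the bound of [f] as the dominating constant. Measurability is asked
    of [f \o Y n] for every [f], which holds when [Y n] takes one value per history, and so no
    sigma-algebra on row vectors is involved. The constant value of [Z] on [N] makes [f \o Z] an
    everywhere limit of measurable functions. *)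
Lemma cvg_in_distribution_ae (R : realType) (k : nat) (d : measure_display)
    (T : measurableType d) (P : probability T R) (Y : nat -> T -> 'rV[R]_k)
    (Z : T -> 'rV[R]_k) (N : set T) (z : 'rV[R]_k) :
  measurable N -> P N = 0%E ->
  (forall f : 'rV[R]_k -> R, forall n, measurable_fun setT (f \o Y n)) ->
  (forall w i, ~ N w -> Y n w 0 i @[n --> \oo] --> Z w 0 i) ->
  (forall w, N w -> Z w = z) ->
  cvg_in_distribution P Y P Z.
Proof.
move=> mN PN mY YZ Zz f fc [M [_ fM]].
have fb w : `|f w| <= M + 1 by apply: fM => //; rewrite ltrDl.
have fYZ w : ~ N w -> f (Y n w) @[n --> \oo] --> f (Z w).
  move=> Nw; apply: (@continuous_cvg _ _ _ _ _ _ f); first exact: fc.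
  by apply: cvg_row => i; exact: YZ.
have mZ : measurable_fun setT (f \o Z).
  pose g n w := if w \in N then f z else f (Y n w).
  apply: (@measurable_fun_cvg _ _ _ setT g) => [n|w _].
    apply: measurable_fun_ifT => //; last exact: mY.
    exact: measurable_fun_in_set.
  rewrite /g; have [Nw|Nw] := boolP (w \in N).
    by rewrite /= Zz; [exact: cvg_cst|rewrite inE in Nw].
  by apply: fYZ => h; move/negP: Nw; apply; rewrite inE.
rewrite unlock.
have := @dominated_convergence _ _ _ P setT measurableT
  (fun n w => (f (Y n w))%:E) (fun w => (f (Z w))%:E) (cst (M + 1)%:E).
case=> //.
- by move=> n; apply/measurable_EFinP; exact: mY.
- exact/measurable_EFinP.
- exists N; split=> // w /= H; apply: contrapT => Nw; apply: H => _.
  by apply: cvg_EFin; [exact: nearW|exact: fYZ].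
- exact: finite_measure_integrable_cst.
- by apply: aeW => w n _; rewrite lee_fin.
Qed.

Lemma outdegrees_local n : local n (fun h => outdegrees h n).
Proof.
move=> h h' hh; rewrite /outdegrees; congr sort; apply: eq_map => v.
by rewrite !degE; exact: deg_local.
Qed.

Lemma adjmx_local (R : realType) n : local n (fun h => adjmx R h n).
Proof.
have e h h' : agree n h h' -> forall u v : 'I_n, tree_edge h u v = tree_edge h' u v.
  move=> hh u v; rewrite /tree_edge /=; case: ltnP => //= v0.
  by rewrite hh // v0 /=.
by move=> h h' hh; apply/matrixP => u v; rewrite !mxE !(e _ _ hh).
Qed.

Lemma top_outdeg_le h n i j : (i <= j)%N -> (top_outdeg h n j <= top_outdeg h n i)%N.
Proof.
move=> ij; rewrite /top_outdeg; have [jn|nj] := ltnP j (size (outdegrees h n)); last first.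
  by rewrite [leqLHS]nth_default.
have so : sorted geq (outdegrees h n) by apply: sort_sorted => x y; exact: leq_total.
have gt : transitive geq by move=> x y z xy yz; exact: leq_trans yz xy.
have ge_refl : reflexive geq by move=> x; exact: leqnn.
by apply: (sorted_leq_nth gt ge_refl 0%N so) => //; rewrite inE /= (leq_ltn_trans ij).
Qed.

Lemma powRN_cvg0 (R : realType) (r : R) : 0 < r -> n%:R `^ (- r) @[n --> \oo] --> (0 : R).
Proof.
move=> r0; apply/cvgrPdist_le => e e0; near=> n.
have n0 : (0 < n)%N by near: n; exists 1%N.
have nr0 : 0 < n%:R `^ r :> R by rewrite powR_gt0 // ltr0n.
rewrite sub0r normrN ger0_norm ?powR_ge0 // powRN -[leRHS]invrK.
rewrite lef_pV2 ?posrE ?invr_gt0 //.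
apply: (@le_trans _ _ ((e^-1 `^ r^-1) `^ r)).
  by rewrite -powRrM mulVf ?gt_eqF // powRr1 // invr_ge0 ltW.
by apply: ler_powR_base; [exact: ltW|exact: powR_ge0|near: n; exact: nbhs_infty_ger].
Unshelve. all: by end_near. Qed.

Section EigenvalueLimit.
Variables (R : realType) (a : R) (ha : -1 < a).
Local Notation gam := (a + 2).
Local Notation th := (gam^-1).
Local Notation eta := (th ^+ 2 / 4).
Local Notation threshold := (threshold a).
Variables (h : nat -> nat) (hr : recursive_tree h).
Hypothesis late : \forall n \near \oo, forall v,
  (threshold n <= v)%N -> (deg h n v)%:R <= n%:R `^ (th - eta) :> R.

(** Divided by [n ^ (th / 2)], the two spectral estimates with [m = n ^ (th - eta)] become functions
    of [y n] and of [z n = n ^ (- eta)], which tends to [0]; both sides of the squeeze tend to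
    [Num.sqrt x]. Positivity of [x] gives the condition [m < Delta i] of the lower estimate for
    large [n]. *)
Lemma top_eigenvalue_cvg i (x : R) : 0 < x ->
  (top_outdeg h n i)%:R / n%:R `^ th @[n --> \oo] --> x ->
  top_eigenvalue R h n i / n%:R `^ (2 * gam)^-1 @[n --> \oo] --> Num.sqrt x.
Proof.
move=> x0 hx; have th0 := growth_exponent_gt0 ha; have th1 := growth_exponent_lt1 ha.
have eta0 : 0 < eta by rewrite divr_gt0 // exprn_gt0.
(* This makes the single [m] dominate the threshold too, besides the late degrees. *)
have et : eta <= th / 2 by rewrite expr2; nra.
pose z (n : nat) : R := n%:R `^ (- eta).
pose y n : R := (top_outdeg h n i)%:R / n%:R `^ th.
have z0 : z @ \oo --> (0 : R) by exact: powRN_cvg0.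
have yz : (y n - z n) @[n --> \oo] --> x by rewrite -[x]subr0; exact: cvgB.
have s2z : 2 * Num.sqrt (z n) @[n --> \oo] --> (0 : R).
  rewrite -[X in _ --> X](mulr0 2); apply: cvgMr; rewrite -(@sqrtr0 R).
  by apply: continuous_cvg; first exact: sqrt_continuous.
have lo : (Num.sqrt (y n - z n) - 2 * Num.sqrt (z n)) @[n --> \oo] --> Num.sqrt x.
  rewrite -[X in _ --> X]subr0; apply: cvgB => //.
  by apply: continuous_cvg; first exact: sqrt_continuous.
have hi : (Num.sqrt (y n) + 2 * Num.sqrt (z n)) @[n --> \oo] --> Num.sqrt x.
  rewrite -[X in _ --> X]addr0; apply: cvgD => //.
  by apply: continuous_cvg; first exact: sqrt_continuous.
apply: (squeeze_cvgr _ lo hi).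
have /cvgrPdist_lt/(_ x x0) yzx := yz.
near=> n.
have n0 : (0 < n)%N by near: n; exists 1%N.
have hin : (i < n)%N by near: n; exists i.+1.
have nR : 0 < n%:R :> R by rewrite ltr0n.
have n1 : 1 <= n%:R :> R by rewrite (ler_nat _ 1).
have nth0 : 0 < n%:R `^ th :> R by rewrite powR_gt0.
have yzn : 0 < y n - z n.
  have : `|x - (y n - z n)| < x by near: n.
  by rewrite ltr_norml => /andP[_]; lra.
pose m : R := n%:R `^ (th - eta).
have mE : m = z n * n%:R `^ th by rewrite /m addrC powRD_gt0.
have DE : (top_outdeg h n i)%:R = y n * n%:R `^ th by rewrite /y divfK // gt_eqF.
have tm : (threshold n)%:R <= m.
  by apply: le_trans (threshold_le _ _) _; apply: ler_powR => //; lra.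
have tail (u : 'I_n) : (threshold n <= u)%N -> (outdeg h u)%:R <= m.
  by rewrite degE /m; move: (val u); near: n; exact: late.
have sE : n%:R `^ (2 * gam)^-1 = Num.sqrt (n%:R `^ th).
  rewrite -powR12_sqrt ?powR_ge0 // -powRrM; congr (_ `^ _).
  by rewrite invfM mulrC.
have s0 : 0 < Num.sqrt (n%:R `^ th) :> R by rewrite sqrtr_gt0.
have up := top_eigenvalue_le hr tm tail hin.
have dn := top_eigenvalue_ge hr tm tail hin.
have y0 : 0 <= y n by rewrite /y divr_ge0 // ltW.
have zn0 : 0 <= z n by exact: powR_ge0.
have e1 : Num.sqrt ((top_outdeg h n i)%:R - m) = Num.sqrt (y n - z n) * Num.sqrt (n%:R `^ th).
  by rewrite DE mE -mulrBl sqrtrM // ltW.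
have e2 : Num.sqrt m = Num.sqrt (z n) * Num.sqrt (n%:R `^ th) by rewrite mE sqrtrM.
have e3 : Num.sqrt (top_outdeg h n i)%:R = Num.sqrt (y n) * Num.sqrt (n%:R `^ th).
  by rewrite DE sqrtrM.
have mD : m < (top_outdeg h n i)%:R by rewrite DE mE ltr_pM2r //; lra.
rewrite sE; apply/andP; split.
  rewrite ler_pdivlMr //; apply: le_trans (dn mD).
  by rewrite e1 e2 mulrBl mulrA.
rewrite ler_pdivrMr //; apply: le_trans up _.
by rewrite e3 e2 [leRHS]mulrDl mulrA.
Unshelve. all: by end_near. Qed.

End EigenvalueLimit.

Theorem theorem4p10 (R : realType) (a : R) (ha : -1 < a)
    (d : measure_display) (Omega : measurableType d) (P : probability Omega R)
    (par : nat -> {RV P >-> nat}) (hpar : linear_pref_attachment a par)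
    (k : nat) (hk : (1 <= k)%N) :
  let gamma := a + 2 in
  let T (w : Omega) : nat -> nat := fun m => par m w in
  exists (d' : measure_display) (Omega' : measurableType d')
    (P' : probability Omega' R) (X : 'I_k -> {RV P' >-> R}),
    [/\ (forall (i j : 'I_k) (w : Omega'), (i <= j)%N -> X j w <= X i w),
        (forall (i : 'I_k) (w : Omega'), 0 < X i w),
        cvg_in_distribution P
          (fun n w => \row_(i < k)
             ((top_outdeg (T w) n i)%:R / (n%:R `^ gamma^-1)))
          P' (fun w => \row_(i < k) X i w) &
        cvg_in_distribution P
          (fun n w => \row_(i < k)
             (top_eigenvalue R (T w) n i / (n%:R `^ (2 * gamma)^-1)))
          P' (fun w => \row_(i < k) Num.sqrt (X i w))].
Proof.
move=> gamma T.
have th0 := growth_exponent_gt0 ha.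
pose eta : R := (gamma^-1 ^+ 2) / 4.
have eta0 : 0 < eta by rewrite divr_gt0 // exprn_gt0.
(* [K] meets two demands on the times [j ^ K]: [K / gamma >= 12] for the martingale increments, and
   [K * eta >= 2] so that the late degrees contribute [O(j ^ (- 2))]. *)
pose K := (Num.truncn (12 * gamma + 2 / eta)).+1.
have K1 : 12 * gamma + 2 / eta < K%:R.
  have Q0 : 0 <= 12 * gamma + 2 / eta.
    apply: addr_ge0; last by rewrite divr_ge0 // ltW.
    by apply: mulr_ge0 => //; exact/ltW/gamma_gt0.
  by have /andP[] := truncn_itv Q0.
have hK : 12 * gamma <= K%:R.
  by apply: le_trans (ltW K1); rewrite lerDl; apply: divr_ge0 => //; exact: ltW.
have hKeta : 2 <= K%:R * eta.
  rewrite -ler_pdivrMr //; apply: le_trans (ltW K1); rewrite lerDr.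
  by apply: mulr_ge0 => //; exact/ltW/gamma_gt0.
have hr w : recursive_tree (T w) by exact: tree_recursive hpar w.
have pos : \forall w \ae P, forall i, ~ ((top_outdeg (T w) n i)%:R / n%:R `^ gamma^-1
    @[n --> \oo] --> (0 : R)).
  by apply/ae_foralln => i; exact: (top_outdeg_limit_neq0 ha hpar).
have late := late_degrees ha hpar.
have incr := mart_increments ha hpar hK.
have := filterI late (filterI incr pos).
case=> N [mN PN sN].
pose x i w : R := limn (fun n => (top_outdeg (T w) n i)%:R / n%:R `^ gamma^-1).
have cx i w : ~ N w -> (top_outdeg (T w) n i)%:R / n%:R `^ gamma^-1
    @[n --> \oo] --> x i w.
  move=> Nw; apply: (top_outdeg_cvg ha hK hKeta (hr w)).
  - by apply: contrapT => H; apply: Nw; apply: sN => -[].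
  - by apply: contrapT => H; apply: Nw; apply: sN => -[_ []].
have xpos i w : ~ N w -> 0 < x i w.
  move=> Nw; have cxw := cx i w Nw; rewrite lt_neqAle; apply/andP; split.
    apply/eqP => x0; apply: Nw; apply: sN => -[_ [_ /(_ i)]]; apply.
    by rewrite x0.
  by rewrite -(cvg_lim _ cxw) //; apply: limr_ge; [apply/cvg_ex; eexists; exact: cxw|
    apply: nearW => n; rewrite divr_ge0 ?powR_ge0].
have xle (i j : nat) w : ~ N w -> (i <= j)%N -> x j w <= x i w.
  move=> Nw ij; apply: (ler_cvg_to (cx j w Nw) (cx i w Nw)); apply: nearW => n.
  by rewrite ler_wpM2r ?invr_ge0 ?powR_ge0 // ler_nat top_outdeg_le.
(* Order and positivity are required at every point, hence the value [1] on the null set [N]. *)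
pose X0 i w : R := if w \in N then 1 else x i w.
have X0N i w : N w -> X0 i w = 1 by move=> Nw; rewrite /X0 mem_set.
have X0E i w : ~ N w -> X0 i w = x i w by move=> Nw; rewrite /X0 memNset.
have mtop n i : measurable_fun setT (fun w => (top_outdeg (T w) n i)%:R / n%:R `^ gamma^-1 : R).
  apply: (@measurable_tree _ _ _ P a par hpar n
    (fun h => (top_outdeg h n i)%:R / n%:R `^ gamma^-1 : R)) => h h' hh.
  by rewrite /top_outdeg (outdegrees_local hh).
have mX i : measurable_fun setT (X0 i).
  apply: (@measurable_fun_cvg _ _ _ setT (fun n w => if w \in N then 1 else
     (top_outdeg (T w) n i)%:R / n%:R `^ gamma^-1)) => [n|w _].
    apply: measurable_fun_ifT => //.
    exact: measurable_fun_in_set.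
  have [Nw|Nw] := pselect (N w).
    by rewrite X0N // mem_set //; exact: cvg_cst.
  by rewrite X0E // memNset //; exact: cx.
pose X (i : 'I_k) : {RV P >-> R} :=
  HB.pack (X0 i) (isMeasurableFun.Build _ _ _ _ (X0 i) (mX i)).
exists d, Omega, P, X; split.
- move=> i j w ij /=; have [Nw|Nw] := pselect (N w); first by rewrite !X0N.
  by rewrite !X0E //; exact: xle.
- move=> i w /=; have [Nw|Nw] := pselect (N w); first by rewrite X0N.
  by rewrite X0E //; exact: xpos.
- apply: (@cvg_in_distribution_ae _ _ _ _ _ _ _ N (\row_i 1)) => //.
  + move=> f n; apply: (@measurable_tree _ _ _ P a par hpar n
      (fun h => f (\row_(i < k) ((top_outdeg h n i)%:R / n%:R `^ gamma^-1)))) => h h' hh.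
    congr f; apply/rowP => i; rewrite !mxE.
    by rewrite /top_outdeg (outdegrees_local hh).
  + move=> w i Nw; rewrite mxE /= X0E //; under eq_cvg do rewrite mxE; exact: cx.
  + by move=> w Nw; apply/rowP => i; rewrite !mxE /= X0N.
apply: (@cvg_in_distribution_ae _ _ _ _ _ _ _ N (\row_i 1)) => //.
- move=> f n; apply: (@measurable_tree _ _ _ P a par hpar n
    (fun h => f (\row_(i < k) (top_eigenvalue R h n i / n%:R `^ (2 * gamma)^-1)))) => h h' hh.
  congr f; apply/rowP => i; rewrite !mxE.
  by rewrite /top_eigenvalue (adjmx_local R hh).
- move=> w i Nw; rewrite mxE /= X0E //; under eq_cvg do rewrite mxE.
  apply: top_eigenvalue_cvg => //; [|exact: xpos|exact: cx].
  by apply: contrapT => H; apply: Nw; apply: sN => -[].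
by move=> w Nw; apply/rowP => i; rewrite !mxE /= X0N // sqrtr1.
Qed.
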